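(* Let $\ell,r\ge 3$ be integers such that $\mathrm{ex}(n,\mathcal{C}_{[\ell]}^{r})\ge n^{1+\frac{1}{\lfloor \ell/2\rfloor}-o(1)}$ as $n\to\infty$. Let $\widehat{\mathcal{C}}_{[\ell]}^{r}$ consist of all the elements of $\mathcal{C}_{[\ell]}^{r}$ which are not sunflowers. Then for all $r$-graphs $H$ with maximum degree at most $\Delta$, $$\mathrm{ex}(H,\widehat{\mathcal{C}}_{[\ell]}^{r})\ge \Delta^{-1+\frac{1}{(r-1)\lfloor \ell/2\rfloor}-o(1)}\cdot e(H),$$ and this bound is tight up to the $o(1)$ term in the exponent for $H=K^r_{\Delta^{1/(r-1)}}$, i.e. $\mathrm{ex}(K^r_{\Delta^{1/(r-1)}},\widehat{\mathcal{C}}_{[\ell]}^{r})\le \Delta^{-1+\frac{1}{(r-1)\lfloor \ell/2\rfloor}+o(1)}\cdot e(K^r_{\Delta^{1/(r-1)}})$.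
   Context: An $r$-graph is an $r$-uniform hypergraph; $e(H)$ is its number of edges; $K_n^r$ is the complete $r$-graph on $n$ vertices (floors are omitted, so $K^r_{\Delta^{1/(r-1)}}$ means $n=\lfloor\Delta^{1/(r-1)}\rfloor$). The maximum degree of $H$ is the maximum, over vertices, of the number of edges containing the vertex. For a family $\mathcal{F}$ of $r$-graphs, an $r$-graph is $\mathcal{F}$-free if it has no subgraph isomorphic to a member of $\mathcal{F}$; $\mathrm{ex}(H,\mathcal{F})$ is the maximum number of edges in an $\mathcal{F}$-free subgraph of $H$, and $\mathrm{ex}(n,\mathcal{F})=\mathrm{ex}(K_n^r,\mathcal{F})$. If $F,F'$ are hypergraphs with $V(F)\subseteq V(F')$, then $F'$ is a Berge-$F$ if there is a bijection $\phi:E(F)\to E(F')$ with $e\subseteq\phi(e)$ for all $e\in E(F)$. $\mathcal{C}_\ell^r$ is the set of all $r$-uniform Berge-$F$ where $F$ is an $\ell$-cycle (for $\ell=2$, $F$ is a double edge); equivalently, $r$-graphs with exactly $\ell$ distinct edges $e_1,\dots,e_\ell$ for which there are distinct vertices $v_1,\dots,v_\ell$ with $v_i,v_{i+1}\in e_i$ for $1\le i<\ell$ and $v_\ell,v_1\in e_\ell$. $\mathcal{C}_{[\ell]}^r=\bigcup_{\ell'=2}^{\ell}\mathcal{C}_{\ell'}^r$. A hypergraph $S$ is a sunflower if there is a set $K$ (the kernel) with $e\cap e'=K$ for every pair of distinct edges $e,e'\in E(S)$. Unless stated otherwise, asymptotics are as $\Delta\to\infty$ with $r,\ell$ fixed: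 the lower bound means that for every $\varepsilon>0$ there is $\Delta_0$ such that for all $\Delta\ge\Delta_0$ and all $H$ with maximum degree at most $\Delta$ the inequality holds with $o(1)$ replaced by $\varepsilon$; similarly for the upper bound. The hypothesis on $\mathrm{ex}(n,\cdot)$ means that for every $\varepsilon>0$ it holds with $o(1)$ replaced by $\varepsilon$ for all sufficiently large $n$. *)

(* Defs.v *)
From mathcomp Require Import all_boot all_order all_algebra.
From mathcomp Require Import all_classical all_reals all_analysis.

Set Implicit Arguments.
Unset Strict Implicit.
Unset Printing Implicit Defensive.

(* A hypergraph is given by its edge set on a finite vertex type; all vertices
   of the type belong to it, possibly as isolated ones. *)
Definition hypergraph (V : finType) := {set {set V}}.

Definition is_rgraph (r : nat) (V : finType) (H : hypergraph V) : Prop :=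
  forall e, e \in H -> #|e| = r.

Definition max_degree (V : finType) (H : hypergraph V) : nat :=
  \max_(v : V) #|[set e in H | v \in e]|.

Definition complete_rgraph (r n : nat) : hypergraph 'I_n :=
  [set e : {set 'I_n} | #|e| == r].

Definition hypergraph_family := forall V : finType, hypergraph V -> Prop.

Definition has_copy (U : finType) (F : hypergraph U)
    (V : finType) (H : hypergraph V) : Prop :=
  exists2 f : U -> V, injective f & forall e, e \in F -> f @: e \in H.

Definition family_free (C : hypergraph_family) (V : finType) (H : hypergraph V) : Prop :=
  forall (U : finType) (F : hypergraph U), C U F -> ~ has_copy F H.

Definition turan (C : hypergraph_family) (V : finType) (H : hypergraph V) : nat :=
  \max_(G : {set {set V}} | (G \subset H) && `[< family_free C G >]) #|G|.

(* [F] is a multi-hypergraph on [U] whose edges are indexed by [E], so that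
   repeated edges are allowed.  The inclusion V(F) <= V(F') is rendered, up to
   renaming vertices, by the injection [i]. *)
Definition berge (U E : finType) (F : E -> {set U}) : hypergraph_family :=
  fun V F' => exists (i : U -> V) (phi : E -> {set V}),
    [/\ injective i, injective phi, F' = [set phi e | e : E] &
        forall e, i @: F e \subset phi e].

(* For l = 2 both indices give the edge {0, 1}: this is the double edge. *)
Definition cycle_graph (l : nat) : 'I_l -> {set 'I_l} :=
  fun i => [set i; ordS i].

Definition berge_cycle (l r : nat) : hypergraph_family :=
  fun V F => is_rgraph r F /\ berge (@cycle_graph l) F.

Definition berge_cycles_upto (l r : nat) : hypergraph_family :=
  fun V F => exists l' : nat, 2 <= l' <= l /\ berge_cycle l' r F.

Definition sunflower (V : finType) (S : hypergraph V) : Prop :=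
  exists K : {set V},
    forall e e', e \in S -> e' \in S -> e != e' -> e :&: e' = K.

Definition nonsunflower_berge_cycles_upto (l r : nat) : hypergraph_family :=
  fun V F => berge_cycles_upto l r F /\ ~ sunflower F.

(* Main.v *)
Require Import Defs.
From mathcomp Require Import all_boot all_order all_algebra.
From mathcomp Require Import all_classical all_reals all_analysis.
From mathcomp Require Import zify ring lra.
From mathcomp Require Import fintype finset bigop.
Import Order.TTheory GRing.Theory Num.Theory.
Set Implicit Arguments.
Unset Strict Implicit.
Unset Printing Implicit Defensive.

(* Upper bound. In a hypergraph without non-sunflower Berge cycles every edge e
   has a pair of vertices contained in no other edge. These pairs form a graph
   with as many edges and no cycle of length at most l (a Berge cycle through
   the pairs cannot be a sunflower, as the kernel would contain a pair), so the
   Moore bound applies.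

   Lower bound. Call a set S of 1 < i < r vertices heavy if its degree exceeds
   D^((r-i)/(r-1)). If half of the edges of H contain no heavy set, colour the
   vertices at random with about D^(1/(r-1)) colours and pull back an extremal
   hypergraph F without Berge cycles: the edges whose image is an edge of F not
   shared with any edge meeting them contain no Berge cycle at all. Otherwise
   restrict to the edges e with a heavy kernel S(e) of a fixed size i and of
   degree about M, select each kernel with probability about M/D, discard the
   edges that see a conflict, and merge the remaining disjoint kernels into
   single vertices. This yields an (r-i+1)-graph of maximum degree O(M), to
   which induction on r applies; M >= D^((r-i)/(r-1)) makes the exponents match.
   Iterated merging leaves edges that are unions of disjoint blocks, such that
   the quotient has no short Berge cycle; then every short Berge cycle of the
   original hypergraph is a sunflower whose kernel is a block. *)

(** * Closed walks and Berge cycles *)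

(* A closed walk v_1 e_1 v_2 e_2 ... is the cyclic list of the pairs (v_i, e_i);
   [link] says that v_i and v_(i+1) lie in e_i. *)
Definition link (V : finType) (p q : V * {set V}) := (p.1 \in p.2) && (q.1 \in p.2).

(* [sorted step_neq] forbids backtracking everywhere except at the base point of
   the closed walk; [nonbacktracking_cycle] needs no more than that. *)
Definition step_neq (V : finType) (p q : V * {set V}) :=
  (p.1 != q.1) && (p.2 != q.2).

(** Such a list [s] is a Berge cycle of G. Length 2 counts, so for l at least 2 any two edges share
    at most one vertex. *)
Definition cycle_free (l : nat) (V : finType) (G : {set {set V}}) : Prop :=
  forall s : seq (V * {set V}), cycle (@link V) s ->
    uniq (unzip1 s) -> uniq (unzip2 s) -> {subset unzip2 s <= G} ->
    1 < size s -> ~~ (size s <= l).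

Lemma map_not_uniqP (T U : eqType) (f : T -> U) (s : seq T) :
  ~~ uniq (map f s) ->
  exists s1 p s2 q s3, s = s1 ++ p :: s2 ++ q :: s3 /\ f p = f q.
Proof.
elim: s => //= x s IHs; rewrite negb_and negbK => /orP[/mapP[y y_s fxy]|/IHs].
  by exists nil, x; case/splitPr: y_s => s2 s3; exists s2, y, s3.
by case=> s1 [p [s2 [q [s3 [-> fpq]]]]]; exists (x :: s1), p, s2, q, s3.
Qed.

Lemma cycle_link_cut (V : finType) (s1 s2 s3 : seq (V * {set V})) p q :
  p.1 = q.1 -> cycle (@link V) (s1 ++ p :: s2 ++ q :: s3) ->
  cycle (@link V) (p :: s2).
Proof.
move=> pq; rewrite -(rot_cycle (size s1)) rot_size_cat /=.
rewrite -!catA /= rcons_cat cat_path /= => /and3P[p2 lq _].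
by rewrite rcons_path p2 /=; move: lq; rewrite /link pq.
Qed.

Lemma sorted_infix (T : Type) (e : rel T) (s1 s2 s3 : seq T) :
  sorted e (s1 ++ s2 ++ s3) -> sorted e s2.
Proof. by case/cat_sorted2=> _ /cat_sorted2[]. Qed.

(** Induction on the length. A repeated vertex or edge cuts off a shorter closed walk, still of
    length at least 2 because repetitions are never adjacent. The new seam may backtrack, which
    [sorted] does not look at. *)
Lemma nonbacktracking_cycle (V : finType) (s : seq (V * {set V})) :
  cycle (@link V) s -> sorted (@step_neq V) s -> 1 < size s ->
  exists t : seq (V * {set V}), [/\ cycle (@link V) t, uniq (unzip1 t),
    uniq (unzip2 t), {subset unzip2 t <= unzip2 s} & 1 < size t <= size s].
Proof.
have [n] := ubnP (size s); elim: n s => // n IHn s les cs ns s_gt1.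
suff: (uniq (unzip1 s) && uniq (unzip2 s)) \/ exists t : seq (V * {set V}),
    [/\ cycle (@link V) t, sorted (@step_neq V) t, 1 < size t,
        size t < size s & {subset t <= s}].
  case=> [/andP[u1 u2]|[t [ct nt t_gt1 lts subts]]].
    by exists s; split=> //; rewrite s_gt1 leqnn.
  have [|t' [ct' u1 u2 sub /andP[t'1 let']]] := IHn t _ ct nt t_gt1.
    by rewrite -ltnS; apply: leq_trans les; rewrite ltnS.
  exists t'; split=> // [x /sub/mapP[y /subts ys ->]|]; first exact: map_f.
  by rewrite t'1 (leq_trans let') // ltnW.
case: (boolP (uniq (unzip1 s))) => [_|/map_not_uniqP]; last first.
  case=> s1 [p [s2 [q [s3 [def_s pq]]]]]; right; exists (p :: s2).
  move: cs ns; rewrite def_s => cs ns; split.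
  - exact: cycle_link_cut pq cs.
  - by move: ns; rewrite -cat_cons; apply: sorted_infix.
  - case: s2 {def_s cs} ns => //= /cat_sorted2[_] /=.
    by rewrite /step_neq pq eqxx.
  - by rewrite !size_cat /= size_cat /=; lia.
  - by move=> x xs; rewrite mem_cat -cat_cons mem_cat xs orbT.
case: (boolP (uniq (unzip2 s))) => [_|/map_not_uniqP]; first by left.
(* For a repeated edge [p] is dropped: the common edge contains the first vertex of [s2] as well as
   [q.1], so [q] closes the walk. *)
case=> s1 [p [s2 [q [s3 [def_s pq]]]]]; right; exists (rcons s2 q).
move: cs ns; rewrite def_s => cs ns.
have s2n : s2 != [::].
  case: s2 {def_s cs} ns => //= /cat_sorted2[_] /=.
  by rewrite /step_neq pq eqxx andbF.
split.
- move: cs; rewrite -(rot_cycle (size s1)) rot_size_cat /=.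
  rewrite -catA /= rcons_cat rcons_cons cat_path /=.
  case: s2 s2n {def_s ns} => //= a s2 _ /andP[/andP[la p2] /andP[lq q3]].
  rewrite !rcons_path p2 /= last_rcons; apply/andP; split=> //.
  have qq : q.1 \in q.2.
    by case: (s3 ++ s1) q3 => [|z z'] /= /andP[] // /andP[].
  by rewrite /link qq -pq; case/andP: la.
- move: ns; rewrite -cat1s -cat_rcons catA; apply: sorted_infix.
- by rewrite size_rcons ltnS lt0n size_eq0.
- by rewrite size_rcons !size_cat /= size_cat /=; lia.
- by move=> x; rewrite mem_rcons mem_cat !inE mem_cat inE => /orP[->|->]; rewrite !orbT.
Qed.

(** A repeated vertex splits the trail into two closed trails through that vertex, which are not
    both constant unless the whole trail is. Distinctness of the edges passes to either half. *)
Lemma trail_cycle (V : finType) (s : seq (V * {set V})) :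
  cycle (@link V) s -> uniq (unzip2 s) -> ~~ constant (unzip1 s) ->
  exists t : seq (V * {set V}), [/\ cycle (@link V) t, uniq (unzip1 t),
    uniq (unzip2 t), {subset unzip2 t <= unzip2 s} & 1 < size t <= size s].
Proof.
have [n] := ubnP (size s); elim: n s => // n IHn s les cs us ncs.
case: (boolP (uniq (unzip1 s))) => [u1|/map_not_uniqP].
  exists s; split=> //; rewrite leqnn andbT.
  by case: s ncs {les cs us u1} => // a [].
case=> s1 [p [s2 [q [s3 [def_s pq]]]]].
pose s' := p :: s2 ++ q :: s3 ++ s1.
have rs : rot (size s1) s = s' by rewrite def_s rot_size_cat /= -catA.
have szs : size s = size s' by rewrite -rs size_rot.
have mem_s x : (x \in unzip2 s) = (x \in unzip2 s').
  by rewrite -rs /unzip2 map_rot mem_rot.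
have us' : uniq (unzip2 s') by rewrite -rs /unzip2 map_rot rot_uniq.
have cs' : cycle (@link V) s' by rewrite -rs rot_cycle.
have c1 : cycle (@link V) (p :: s2).
  by apply: (@cycle_link_cut _ [::] s2 (s3 ++ s1) p q).
have c2 : cycle (@link V) (q :: s3 ++ s1).
  apply: (@cycle_link_cut _ [::] (s3 ++ s1) s2 q p) => //.
  have -> : [::] ++ q :: (s3 ++ s1) ++ p :: s2 = rot (size (p :: s2)) s'.
    by rewrite -cat_cons -cat_cons -/s' /s' -cat_cons rot_size_cat.
  by rewrite rot_cycle.
have /orP[nc|nc] : ~~ constant (unzip1 (p :: s2)) || ~~ constant (unzip1 (q :: s3 ++ s1)).
  rewrite -negb_and; apply: contra ncs => /andP[/= k1 k2].
  suff : constant (unzip1 s').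
    move=> ks'; have : all (pred1 p.1) (unzip1 s').
      by move: ks'; rewrite /= eqxx.
    have E : unzip1 s' =i unzip1 s by move=> x; rewrite -rs /unzip1 map_rot mem_rot.
    rewrite (eq_all_r E) => al.
    case: (unzip1 s) al => //= a l /andP[/eqP-> ]; exact.
  rewrite /= /unzip1 map_cat all_cat [all _ (map _ s2)]k1 /= pq eqxx /=.
  exact: k2.
- have [||||t [ct t1 t2 subt /andP[t_gt1 let_]]] := IHn (p :: s2) => //.
  + by move: les; rewrite szs /s' /= size_cat /=; lia.
  + by move: us'; rewrite /s' -cat_cons /unzip2 map_cat cat_uniq => /andP[].
  exists t; split=> //; last first.
    by rewrite t_gt1 szs (leq_trans let_) // /s' /= !size_cat /= ?size_cat; lia.
  by move=> x /subt; rewrite mem_s /s' -cat_cons /unzip2 map_cat mem_cat => ->.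
- have [||||t [ct t1 t2 subt /andP[t_gt1 let_]]] := IHn (q :: s3 ++ s1) => //.
  + by move: les; rewrite szs /s' /= size_cat /=; lia.
  + by move: us'; rewrite /s' -cat_cons /unzip2 map_cat cat_uniq => /and3P[].
  exists t; split=> //; last first.
    by rewrite t_gt1 szs (leq_trans let_) // /s' /= !size_cat /= ?size_cat; lia.
  by move=> x /subt xs; rewrite mem_s /s' -cat_cons /unzip2 map_cat mem_cat [X in _ || X]xs orbT.
Qed.

(** * Closed walks, tame hypergraphs and the forbidden families *)

Lemma cycle_ordSP (T : Type) (R : rel T) (x0 : T) (s : seq T) :
  cycle R s <-> (forall i : 'I_(size s), R (nth x0 s i) (nth x0 s (ordS i))).
Proof.
case: s => [|x s]; first by split=> // _ [].
rewrite [cycle _ _]/=.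
have E i (lti : i < size (x :: s)) :
    R (nth x0 (x :: rcons s x) i) (nth x0 (rcons s x) i) =
    R (nth x0 (x :: s) i) (nth x0 (x :: s) (ordS (Ordinal lti))).
  rewrite -rcons_cons !nth_rcons lti.
  move: (lti); rewrite /= ltnS leq_eqVlt => /predU1P[eqi|lti'].
    by rewrite eqi ltnn eqxx modnn.
  by rewrite lti' modn_small.
split=> [/(pathP x0) h [i lti]|h].
  by rewrite -E; apply: h; rewrite size_rcons.
apply/(pathP x0) => i; rewrite size_rcons => lti; rewrite (E _ lti).
exact: (h (Ordinal (lti : i < size (x :: s)))).
Qed.

Lemma cycle_ordS_map (T : Type) (R : rel T) (m : nat) (f : 'I_m -> T) :
  (forall i, R (f i) (f (ordS i))) -> cycle R [seq f i | i <- enum 'I_m].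
Proof.
case: m f => [|m] f h; first by rewrite (size0nil (size_enum_ord 0)).
rewrite cycle_map; apply/(cycle_ordSP _ ord0); rewrite size_enum_ord => i /=.
rewrite nth_ord_enum -[i.+1 %% _]/(val (ordS i)) nth_ord_enum; exact: h.
Qed.

(* The fibres of rho are the merged kernels: every edge of G is a union of fibres,
   and no Berge cycle of length 2..l survives the merging. *)
Definition tame (l : nat) (V : finType) (G : {set {set V}}) : Prop :=
  exists2 rho : V -> V,
    (forall e, e \in G -> forall x y, x \in e -> rho y = rho x -> y \in e) &
    cycle_free l [set rho @: (e : {set V}) | e in G].

Lemma turan_ge (C : hypergraph_family) (V : finType) (H G : {set {set V}}) :
  G \subset H -> family_free C G -> #|G| <= turan C H.
Proof.
move=> sGH fG; rewrite /turan; 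
apply: (@leq_bigmax_cond _ (fun G0 : {set {set V}} =>
  (G0 \subset H) && `[< family_free C G0 >]) (fun G0 => #|G0|) G).
by rewrite sGH; apply/asboolP.
Qed.

(** The alternative [G = set0] covers a family that no subgraph of H avoids: the maximum then ranges
    over nothing and is 0. *)
Lemma turan_attained (C : hypergraph_family) (V : finType) (H : {set {set V}}) :
  exists G : {set {set V}}, [/\ G \subset H, G = set0 \/ family_free C G & #|G| = turan C H].
Proof.
have [P0|Pn] := posnP #|[pred G : {set {set V}} | (G \subset H) && `[< family_free C G >]]|.
  exists set0; split; rewrite ?sub0set //; first by left.
  by rewrite cards0 /turan big_pred0 // => G; have := card0_eq P0 G.
have [G /andP[sGH /asboolP fG] eqG] := eq_bigmax_cond (fun G : {set {set V}} => #|G|) Pn.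
by exists G; split=> //; right.
Qed.

Lemma is_rgraph_complete (r n : nat) (G : {set {set 'I_n}}) :
  G \subset complete_rgraph r n -> is_rgraph r G.
Proof. by move=> /subsetP sG e /sG; rewrite inE => /eqP. Qed.

(** Position i of the walk gives the images of vertex i and of edge i of the indexed cycle; [link]
    is exactly the inclusion that a Berge copy demands. *)
Lemma berge_cycle_of_link_cycle (l r : nat) (V : finType) (s : seq (V * {set V})) :
  cycle (@link V) s -> uniq (unzip1 s) -> uniq (unzip2 s) ->
  (forall e, e \in unzip2 s -> #|e| = r) -> 1 < size s -> size s <= l ->
  berge_cycles_upto l r [set e in unzip2 s].
Proof.
move=> cs u1 u2 rs s_gt1 s_lel.
case def_s : s (s_gt1) => [//|p0 s'] _; rewrite -def_s.
pose w (i : 'I_(size s)) := (nth p0 s i).1.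
pose e (i : 'I_(size s)) := (nth p0 s i).2.
have lk := (cycle_ordSP (@link V) p0 s).1 cs.
exists (size s); rewrite s_gt1 s_lel; split=> //; split.
  by move=> x; rewrite inE; apply: rs.
exists w, e; split=> [i j|i j||i].
- rewrite /w -!(nth_map p0 p0.1 fst) // => /eqP.
  by rewrite (nth_uniq _ _ _ u1) ?size_map // => /eqP/val_inj.
- rewrite /e -!(nth_map p0 p0.2 snd) // => /eqP.
  by rewrite (nth_uniq _ _ _ u2) ?size_map // => /eqP/val_inj.
- apply/setP => x; rewrite inE; apply/mapP/imsetP => [[p ps ->]|[i _ ->]].
    have lti : index p s < size s by rewrite index_mem.
    by exists (Ordinal lti); rewrite // /e nth_index.
  by exists (nth p0 s i); rewrite // mem_nth.
- apply/subsetP => _ /imsetP[j /set2P[->|->] ->]; by case/andP: (lk i).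
Qed.

Lemma berge_free_cycle_free (l r : nat) (V : finType) (G : {set {set V}}) :
  is_rgraph r G -> family_free (berge_cycles_upto l r) G -> cycle_free l G.
Proof.
move=> rG fG s cs u1 u2 sub s_gt1; apply/negP => s_lel.
apply: (fG V [set e in unzip2 s]).
  by apply: berge_cycle_of_link_cycle => // e /sub/rG.
by exists id => // x; rewrite inE imset_id; apply: sub.
Qed.

Lemma link_cycle_sunflower (l r : nat) (V : finType) (G : {set {set V}})
    (s : seq (V * {set V})) :
  is_rgraph r G -> family_free (nonsunflower_berge_cycles_upto l r) G ->
  cycle (@link V) s -> uniq (unzip1 s) -> uniq (unzip2 s) ->
  {subset unzip2 s <= G} -> 1 < size s -> size s <= l ->
  sunflower [set e in unzip2 s].
Proof.
move=> rG fG cs u1 u2 sub s_gt1 s_lel; apply: contrapT => nsun.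
apply: (fG V [set e in unzip2 s]).
  by split=> //; apply: berge_cycle_of_link_cycle => // e /sub/rG.
by exists id => // x; rewrite inE imset_id; apply: sub.
Qed.

(* A closed trail in an acyclic quotient is constant, so all the edges of a Berge
   cycle contain one common fibre, which is the kernel of a sunflower. *)
Lemma tame_free (l r : nat) (V : finType) (G : {set {set V}}) :
  1 < l -> tame l G -> family_free (nonsunflower_berge_cycles_upto l r) G.
Proof.
move=> l_gt1 [rho fib cf] U F [[m [/andP[m_gt1 m_lel]]]].
case=> [rF [i [phi [inj_i inj_phi def_F sub]]]] nsun [f inj_f cpy].
have mem_phi j : f @: phi j \in G by apply: cpy; rewrite def_F imset_f.
pose v j := f (i j); pose e j := f @: phi j.
have inj_e : injective e by move=> j k /imset_inj => /(_ inj_f) /inj_phi.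
have v_e j : v j \in e j.
  by apply: imset_f; apply: (subsetP (sub j)); apply: imset_f; rewrite !inE eqxx.
have vS_e j : v (ordS j) \in e j.
  by apply: imset_f; apply: (subsetP (sub j)); apply: imset_f; rewrite !inE eqxx orbT.
(* An edge is a union of fibres, hence the full preimage of its image. *)
have inj_rho e1 e2 : e1 \in G -> e2 \in G -> rho @: e1 = rho @: e2 -> e1 = e2.
  move=> e1G e2G eq12; apply/setP => x.
  have h (e3 e4 : {set V}) : e4 \in G -> rho @: e3 = rho @: e4 -> x \in e3 -> x \in e4.
    move=> e4G eq34 /(imset_f rho); rewrite eq34 => /imsetP[y ye4].
    exact: (fib _ e4G _ _ ye4).
  by apply/idP/idP; apply: h.
pose s := [seq (rho (v j), rho @: e j) | j <- enum 'I_m].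
have cs : cycle (@link V) s.
  by apply: cycle_ordS_map => j; rewrite /link /= !imset_f.
have us : uniq (unzip2 s).
  rewrite /unzip2 -map_comp map_inj_uniq ?enum_uniq // => j k /= /inj_rho.
  by move=> /(_ (mem_phi j) (mem_phi k))/inj_e.
have subs : {subset unzip2 s <= [set rho @: (e : {set V}) | e in G]}.
  move=> x /mapP[_ /mapP[j _ ->] ->] /=.
  exact: (imset_f (fun e0 : {set V} => rho @: e0) (mem_phi j)).
case: (boolP (constant (unzip1 s))) => [cst|/(trail_cycle cs us)]; last first.
  case=> t [ct u1 u2 subt /andP[t_gt1 let_]].
  have /negP[] := cf t ct u1 u2 (fun x h => subs _ (subt _ h)) t_gt1.
  by rewrite (leq_trans let_) // size_map size_enum_ord.
case: m m_gt1 m_lel i phi inj_i inj_phi def_F sub mem_phi @v @e inj_e v_e vS_e @s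
    cs us subs cst => // m m_gt1 m_lel i phi inj_i inj_phi def_F sub mem_phi
    v e inj_e v_e vS_e s cs us subs cst.
have cst_v j : rho (v j) = rho (v ord0).
  have mem k : rho (v k) \in unzip1 s.
    by apply/mapP; exists (rho (v k), rho @: e k) => //; apply/mapP; exists k; rewrite ?mem_enum.
  have [n [x def_s]] : exists n x, unzip1 s = nseq n x.
    case: (unzip1 s) cst => [|x s'] => [_|/all_pred1P ->]; first by exists 0, (v ord0).
    by exists (size s').+1, x.
  by move: (mem j) (mem ord0); rewrite def_s !mem_nseq => /andP[_ /eqP->] /andP[_ /eqP->].
(* All core vertices of the cycle lie in one fibre, whose preimage under the embedding [f] is the
   kernel. *)
case: nsun; exists (f @^-1: [set x | rho x == rho (v ord0)]) => a b.
rewrite def_F => /imsetP[j _ {a}->] /imsetP[k _ {b}->] neq_jk.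
apply/setP => x; rewrite !inE; apply/andP/idP => [[xj xk]|/eqP eqx]; last first.
  split; rewrite -(mem_imset _ _ inj_f).
    by apply: (fib _ (mem_phi j)) (v_e j) _; rewrite cst_v.
  by apply: (fib _ (mem_phi k)) (v_e k) _; rewrite cst_v.
have {}neq_jk : rho @: e j != rho @: e k.
  by apply: contra neq_jk => /eqP/inj_rho => /(_ (mem_phi j) (mem_phi k))/inj_e->.
apply/negPn/negP => neqx.
(* A common vertex outside this fibre would give two distinct edges of the quotient a second common
   vertex, that is, a Berge 2-cycle. *)
have := cf [:: (rho (f x), rho @: e j); (rho (v ord0), rho @: e k)].
rewrite l_gt1 /= /link /= !inE neqx neq_jk.
have -> : rho (f x) \in rho @: e j by apply: imset_f; apply: imset_f.
have -> : rho (f x) \in rho @: e k by apply: imset_f; apply: imset_f.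
have -> : rho (v ord0) \in rho @: e j by rewrite -(cst_v j) imset_f.
have -> : rho (v ord0) \in rho @: e k by rewrite -(cst_v k) imset_f.
move=> /(_ isT isT isT) h; apply: notF; apply: h => // z.
by rewrite !inE => /orP[]/eqP->; exact: (imset_f (fun e0 : {set V} => rho @: e0) (mem_phi _)).
Qed.
(** * Counting functions *)

Lemma exists_ge_average (T : finType) (f : T -> nat) (c : nat) :
  0 < #|T| -> c * #|T| <= \sum_x f x -> exists x, c <= f x.
Proof.
case: c => [|c] T_gt0 le_c; first by have /card_gt0P[x _] := T_gt0; exists x.
apply/existsP; apply: contraTT le_c => /existsPn h.
rewrite -ltnNge; apply: (@leq_ltn_trans (c * #|T|)); last by rewrite ltn_pmul2r.
by rewrite mulnC -sum_nat_const; apply: leq_sum => x _; rewrite leqNgt h.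
Qed.

Lemma card_ffun_constrained (V T : finType) (E : {set V}) (B : V -> {set T}) :
  #|[set g : {ffun V -> T} | [forall v in E, g v \in B v]]| =
  (\prod_(v in E) #|B v|) * #|T| ^ #|~: E|.
Proof.
pose F v := [pred y | (v \in E) ==> (y \in B v)].
have -> : #|[set g : {ffun V -> T} | [forall v in E, g v \in B v]]| = #|family F|.
  by apply: eq_card => g; rewrite !inE; apply/forall_inP/familyP => h v;
    [rewrite inE; apply/implyP; apply: h | move=> vE; have := h v; rewrite inE vE].
rewrite card_family foldrE big_map enumT -/(index_enum V) (bigID (mem E)) /=.
congr (_ * _).
  by apply: eq_bigr => v vE; apply: eq_card => y; rewrite unfold_in vE.
rewrite -prod_nat_const big_mkcond [RHS]big_mkcond /=; apply: eq_bigr => v _.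
by rewrite inE; case: ifP => // /negbTE vE; apply: eq_card => y; rewrite !inE vE.
Qed.

(* Exchanging the coordinates in E between two independent functions makes the
   values on E independent of Z and A. *)
Lemma resample (V T : finType) (Z : {set {ffun V -> T}}) (E : {set V})
    (A : {ffun V -> T} -> {set T}) (a : nat) :
  (forall f g : {ffun V -> T}, (forall v, v \notin E -> f v = g v) -> f \in Z -> g \in Z) ->
  (forall f g : {ffun V -> T}, (forall v, v \notin E -> f v = g v) -> A f = A g) ->
  (forall f, f \in Z -> #|A f| <= a) ->
  #|[set f in Z | [forall v in E, f v \in A f]]| * #|T| ^ #|E| <= a ^ #|E| * #|Z|.
Proof.
move=> invZ invA leA.
case: (set_0Vmem Z) => [->|[f0 _]].
  rewrite (_ : [set f in _ | _] = set0) ?cards0 // .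
  by apply/setP => f; rewrite !inE.
have [/card0_eq T0|T_gt0] := posnP #|T|.
  have [->|[v _]] := set_0Vmem E; last by have := T0 (f0 v); rewrite inE.
  rewrite cards0 !expn0 muln1 mul1n; apply: subset_leq_card.
  by apply/subsetP => f; rewrite inE => /andP[].
pose P := [set f in Z | [forall v in E, f v \in A f]].
pose mix (f g : {ffun V -> T}) := [ffun v => if v \in E then g v else f v].
have mixE (f g : {ffun V -> T}) v : v \notin E -> f v = mix f g v.
  by move=> /negbTE vE; rewrite ffunE vE.
pose Q := [set p : {ffun V -> T} * {ffun V -> T} |
  (p.1 \in Z) && [forall v in E, p.2 v \in A p.1]].
have leQ : #|Q| <= #|Z| * (a ^ #|E| * #|T| ^ #|~: E|).
  rewrite -sum1dep_card.
  rewrite -(pair_big_dep (mem Z)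
    (fun f g : {ffun V -> T} => [forall v in E, g v \in A f]) (fun _ _ => 1)) /=.
  rewrite -sum_nat_const; apply: leq_sum => f fZ.
  rewrite sum1dep_card card_ffun_constrained prod_nat_const leq_mul2r.
  by apply/orP; right; case: (#|E|) => // k; rewrite leq_exp2r // leA.
have leP : #|P| * #|T| ^ #|V| <= #|Q|.
  rewrite -card_ffun -cardsT -cardsX.
  (* The swap sends (f, g) with f in P into Q: the first component agrees with f off E, so Z and A
     do not change, and the second carries the values of f on E. *)
  rewrite -[X in X <= _](card_in_imset (f := fun p => (mix p.1 p.2, mix p.2 p.1))).
    apply: subset_leq_card; apply/subsetP => _ /imsetP[[f g] /setXP[/= fP _] ->].
    move: fP; rewrite !inE => /andP[fZ /forall_inP fA] /=.
    rewrite (invZ _ _ (mixE f g)) //=; apply/forall_inP => v vE.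
    by rewrite -(invA _ _ (mixE f g)) ffunE vE fA.
  move=> [f1 g1] [f2 g2] _ _ [/ffunP e1 /ffunP e2]; congr (_, _); apply/ffunP => v;
    move: (e1 v) (e2 v); rewrite !ffunE; by case: ifP.
have := leq_trans leP leQ.
rewrite -(cardsC E) expnD !mulnA leq_pmul2r ?expn_gt0 ?T_gt0 //.
by rewrite (mulnC #|Z|).
Qed.

Lemma double_count (T U : finType) (A : {set U}) (G : T -> {set U}) :
  (forall x, G x \subset A) ->
  \sum_x #|G x| = \sum_(u in A) #|[set x | u \in G x]|.
Proof.
move=> sGA; rewrite (eq_bigr (fun x => \sum_(u in A) (u \in G x))).
  rewrite exchange_big; apply: eq_bigr => u uA.
  rewrite -sum1_card [RHS]big_mkcond; apply: eq_bigr => x _.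
  by rewrite inE; case: (u \in G x).
move=> x _; rewrite -sum1_card big_mkcond [RHS]big_mkcond; apply: eq_bigr => u _ /=.
by case: (boolP (u \in G x)) => [/(subsetP (sGA x)) ->|]; last by case: ifP.
Qed.

Lemma leq_card_bigcup (I T : finType) (P : pred I) (B : I -> {set T}) :
  #|\bigcup_(i | P i) B i| <= \sum_(i | P i) #|B i|.
Proof.
elim/big_rec2: _ => [|i a C _ leC]; first by rewrite cards0.
by apply: leq_trans (leq_card_setU _ _) _; rewrite leq_add2l.
Qed.
(** * Random colourings *)

Definition codegree (V : finType) (H : {set {set V}}) (S : {set V}) : nat :=
  #|[set e in H | S \subset e]|.

Lemma cycle_link_mem (V : finType) (s : seq (V * {set V})) p :
  cycle (@link V) s -> p \in s -> p.1 \in p.2.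
Proof.
move=> cs ps; case/splitPr: ps cs => s1 s2.
rewrite -(rot_cycle (size s1)) rot_size_cat /=.
by case: (s2 ++ s1) => [|q t] /= /andP[/andP[]].
Qed.

Lemma sorted_link (V : finType) (s : seq (V * {set V})) :
  cycle (@link V) s -> sorted (@link V) s.
Proof. by case: s => //= p s; rewrite rcons_path => /andP[]. Qed.

Lemma uniq_map_sorted (T U : eqType) (f : T -> U) (s : seq T) :
  uniq (map f s) -> sorted [rel p q | f p != f q] s.
Proof. by rewrite uniq_pairwise pairwise_map => /pairwise_sorted. Qed.

(** A Berge cycle of G maps to a closed walk in F that does not backtrack: consecutive vertices
    share an edge, where [chi] is injective, and consecutive edges meet, so their images differ.
    From it [nonbacktracking_cycle] extracts a cycle of F that is no longer. *)
Lemma cycle_free_colouring (l : nat) (V W : finType) (chi : V -> W)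
    (G : {set {set V}}) (F : {set {set W}}) :
  cycle_free l F -> (forall e, e \in G -> chi @: e \in F) ->
  (forall e, e \in G -> {in e &, injective chi}) ->
  (forall e e', e \in G -> e' \in G -> e :&: e' != set0 ->
     chi @: e = chi @: e' -> e = e') ->
  cycle_free l G.
Proof.
move=> cfF GF inj loc s cs u1 u2 sub s_gt1; apply/negP => s_lel.
pose h (p : V * {set V}) := (chi p.1, chi @: p.2).
have memG p : p \in s -> p.2 \in G by move=> ps; apply/sub/map_f.
have ch : cycle (@link W) (map h s).
  rewrite cycle_map; apply: sub_cycle cs => p q /andP[pp qp].
  by rewrite /= /link /= !imset_f.
have nh : sorted (@step_neq W) (map h s).
  rewrite sorted_map.
  have : sorted [rel p q | link p q && ((p.1 != q.1) && (p.2 != q.2))] s.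
    rewrite (sorted_relI (@link V) [rel p q | (p.1 != q.1) && (p.2 != q.2)]).
    rewrite (sorted_relI [rel p q | p.1 != q.1] [rel p q | p.2 != q.2]).
    by rewrite sorted_link // (uniq_map_sorted u1) (uniq_map_sorted u2).
  apply: (@sub_in_sorted _ (mem s)); last exact/allP.
  move=> p q ps qs /= /and3P[/andP[pp qp] n1 n2].
  rewrite /step_neq /=; apply/andP; split.
    by apply: contra n1 => /eqP/(inj _ (memG _ ps) _ _ pp qp)->.
  apply: contra n2 => /eqP/(loc _ _ (memG _ ps) (memG _ qs))-> //.
  by apply/set0Pn; exists q.1; rewrite inE qp (cycle_link_mem cs qs).
have [|t [ct t1 t2 subt /andP[t_gt1 let_]]] := nonbacktracking_cycle ch nh.
  by rewrite size_map.
have subF : {subset unzip2 t <= F}.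
  by move=> x /subt /mapP[_ /mapP[p ps ->] ->]; apply/GF/memG.
have /negP[] := cfF t ct t1 t2 subF t_gt1.
by rewrite (leq_trans let_) // size_map.
Qed.

Lemma imset_onto (V W : finType) (e : {set V}) (f : {set W}) :
  #|e| = #|f| -> 0 < #|f| -> exists g : V -> W, g @: e = f.
Proof.
move=> eqef /card_gt0P[y0 y0f]; pose g v := nth y0 (enum f) (index v (enum e)).
exists g; apply/setP => y; apply/imsetP/idP => [[v ve ->]|yf].
  by rewrite -mem_enum mem_nth // -cardE -eqef cardE index_mem mem_enum.
have lti : index y (enum f) < size (enum e) by rewrite -cardE eqef cardE index_mem mem_enum.
have [v0 _] : exists v, v \in e by apply/card_gt0P; rewrite eqef; apply/card_gt0P; exists y0.
exists (nth v0 (enum e) (index y (enum f))); first by rewrite -mem_enum mem_nth.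
by rewrite /g index_uniq ?enum_uniq // nth_index // mem_enum.
Qed.

(** Every edge of F is the image of at least one pattern on e, and the colours outside e are free;
    ignoring the r! orderings costs only a constant. *)
Lemma card_colourings_onto_edges (r : nat) (V W : finType) (F : {set {set W}}) (e : {set V}) :
  0 < r -> is_rgraph r F -> #|e| = r ->
  #|F| * #|W| ^ #|V| <= #|[set chi : {ffun V -> W} | chi @: e \in F]| * #|W| ^ r.
Proof.
move=> r_gt0 rF re.
rewrite -(cardsC e) expnD re mulnCA mulnC leq_mul2r; apply/orP; right.
rewrite -[X in _ <= X]sum1_card.
rewrite (partition_big (fun chi : {ffun V -> W} => chi @: e) (mem F)) /=; last first.
  by move=> chi; rewrite inE.
rewrite -sum_nat_const; apply: leq_sum => f fF; rewrite sum1dep_card.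
have [g eg] : exists g : V -> W, g @: e = f by apply: imset_onto; rewrite rF.
pose B v := [set g v].
have := card_ffun_constrained e B; rewrite big1 ?mul1n => [<-|v _]; last by rewrite cards1.
apply: subset_leq_card; apply/subsetP => chi; rewrite !inE => /forall_inP h.
have -> : chi @: e = f.
  by rewrite -eg; apply: eq_in_imset => v /h; rewrite inE => /eqP.
by rewrite fF eqxx.
Qed.

(** Given the colours on e, a collision forces each vertex of e' outside e into the at most r
    colours of e; [resample] makes these events independent. *)
Lemma card_colliding_colourings (r : nat) (V W : finType) (F : {set {set W}}) (e e' : {set V}) :
  #|e| = r ->
  #|[set chi : {ffun V -> W} | (chi @: e \in F) && (chi @: e == chi @: e')]|
      * #|W| ^ #|e' :\: e|
    <= r ^ #|e' :\: e| * #|[set chi : {ffun V -> W} | chi @: e \in F]|.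
Proof.
move=> re; pose Z := [set chi : {ffun V -> W} | chi @: e \in F].
have agree (f g : {ffun V -> W}) : (forall v, v \notin e' :\: e -> f v = g v) -> f @: e = g @: e.
  by move=> fg; apply: eq_in_imset => v ve; apply: fg; rewrite !inE ve.
apply: leq_trans (@resample _ _ Z (e' :\: e) (fun chi => chi @: e) r _ _ _).
- rewrite leq_mul2r; apply/orP; right; apply: subset_leq_card; apply/subsetP => chi.
  rewrite !inE => /andP[-> /eqP eqc]; apply/forall_inP => v; rewrite inE => /andP[_ ve'].
  by rewrite eqc imset_f.
- by move=> f g /agree fg; rewrite !inE fg.
- exact: agree.
- by move=> f _; rewrite -re leq_imset_card.
Qed.
(** Group the other edges by S = [e :&: e']. With d = r - |S| there are at most y^d of them, each
    colliding with conditional probability at most (r/n)^d. The factor 2^(r+1) in n makes each group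
    cost at most 2^-(r+1), and there are at most 2^r groups. *)
Lemma sum_colliding_colourings (r n y : nat) (V : finType) (H : {set {set V}})
    (F : {set {set 'I_n}}) (e : {set V}) :
  is_rgraph r H -> 0 < y -> r * 2 ^ r.+1 * y <= n -> e \in H ->
  (forall S : {set V}, S \subset e -> S != set0 -> codegree H S <= y ^ (r - #|S|)) ->
  2 * (\sum_(e' in H | (e' != e) && (e :&: e' != set0))
         #|[set chi : {ffun V -> 'I_n} | (chi @: e \in F) && (chi @: e == chi @: e')]|)
    <= #|[set chi : {ffun V -> 'I_n} | chi @: e \in F]|.
Proof.
move=> rH y_gt0 len eH deg; have re := rH e eH.
set X := #|[set chi : {ffun V -> 'I_n} | chi @: e \in F]|.
pose Y (e' : {set V}) :=
  #|[set chi : {ffun V -> 'I_n} | (chi @: e \in F) && (chi @: e == chi @: e')]|.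
pose Q := [set S : {set V} in powerset e | S != set0].
rewrite (partition_big (fun e' => e :&: e') (mem Q)) /=; last first.
  by move=> e' /and3P[_ _ ne]; rewrite !inE subsetIl ne.
have leS S : S \in Q ->
    2 ^ r.+1 * (\sum_(e' | [&& e' \in H, e' != e & e :&: e' != set0] && (e :&: e' == S)) Y e') <= X.
  rewrite !inE => /andP[sSe S0]; set d := r - #|S|.
  (* If S is all of e, then e' contains e and so equals it, which is excluded. *)
  have [d0|d_gt0] := posnP d.
    rewrite big_pred0 ?muln0 // => e'; apply/negP => /andP[/and3P[e'H ne _] /eqP eS].
    have : e \subset e'.
      have -> : e = S by apply/eqP; rewrite eq_sym eqEcard sSe re -subn_eq0 -/d d0.
      by rewrite -eS subsetIr.
    by move=> see'; case/negP: ne; rewrite eq_sym eqEcard see' re rH //= leqnn.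
  have n_gt0 : 0 < n.
    apply: leq_trans len; rewrite !muln_gt0 y_gt0 expn_gt0 /= !andbT.
    by move: d_gt0; rewrite /d; lia.
  have hY e' : e' \in H -> e :&: e' == S -> n ^ d * Y e' <= r ^ d * X.
    move=> e'H /eqP eS; have := @card_colliding_colourings r V 'I_n F e e' re.
    suff -> : #|e' :\: e| = d by rewrite card_ord mulnC.
    by rewrite cardsD rH // setIC eS.
  rewrite -(@leq_pmul2l (n ^ d)) ?expn_gt0 ?n_gt0 // mulnCA big_distrr /=.
  apply: (@leq_trans (2 ^ r.+1 * (y ^ d * (r ^ d * X)))).
    rewrite leq_mul2l; apply/orP; right.
    apply: (@leq_trans (\sum_(e' in [set e' in H | S \subset e']) r ^ d * X)).
      pose Q' e' := [&& e' \in H, e' != e & e :&: e' != set0] && (e :&: e' == S).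
      rewrite [X in _ <= X](bigID Q') /=.
      apply: leq_trans (leq_addr _ _).
      rewrite [X in _ <= X](eq_bigl Q').
        by apply: leq_sum => e' /andP[/and3P[e'H _ _]]; apply: hY.
      move=> e'; rewrite /Q' !inE; case: (e' \in H) => //=.
      by case: (eqVneq (e :&: e') S) => [<-|_]; rewrite ?subsetIr ?andbT ?andbF.
    by rewrite sum_nat_const leq_mul2r deg ?orbT.
  rewrite !mulnA leq_mul2r; apply/orP; right.
  apply: leq_trans (_ : (r * 2 ^ r.+1 * y) ^ d <= _); last by rewrite leq_exp2r.
  rewrite -mulnA (mulnC (y ^ d)) !expnMn mulnA leq_mul2r; apply/orP; right.
  rewrite mulnC leq_mul2l; apply/orP; right.
  by rewrite -expnM leq_exp2l // leq_pmulr.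
rewrite -(@leq_pmul2l (2 ^ r)) ?expn_gt0 // mulnA -expnSr big_distrr /=.
apply: (@leq_trans (\sum_(S in Q) X)); first exact: leq_sum.
rewrite sum_nat_const leq_mul2r; apply/orP; right.
by rewrite -re -card_powerset; apply: subset_leq_card; apply/subsetP => S; rewrite inE => /andP[].
Qed.

(* Keep the edges that a random colouring of the vertices by [n] maps onto an edge
   of F, unless another edge meeting them has the same image. *)
Lemma colouring_subgraph (l r n y : nat) (V : finType) (H : {set {set V}})
    (F : {set {set 'I_n}}) :
  0 < r -> is_rgraph r H -> is_rgraph r F -> cycle_free l F ->
  0 < y -> r * 2 ^ r.+1 * y <= n ->
  (forall e, e \in H -> forall S : {set V}, S \subset e -> S != set0 ->
     codegree H S <= y ^ (r - #|S|)) ->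
  exists G : {set {set V}}, [/\ G \subset H, cycle_free l G &
    #|H| * #|F| <= 2 * #|G| * n ^ r].
Proof.
move=> r_gt0 rH rF cfF y_gt0 len deg.
pose bad (chi : {ffun V -> 'I_n}) (e : {set V}) := [exists e' : {set V},
  [&& e' \in H, e' != e, e :&: e' != set0 & chi @: e == chi @: e']].
pose G (chi : {ffun V -> 'I_n}) := [set e in H | (chi @: e \in F) && ~~ bad chi e].
have n_gt0 : 0 < n.
  by apply: leq_trans len; rewrite !muln_gt0 y_gt0 expn_gt0 r_gt0.
have cfG chi : cycle_free l (G chi).
  apply: (@cycle_free_colouring l V 'I_n chi (G chi) F) => //.
  - by move=> e; rewrite inE => /and3P[].
  - by move=> e; rewrite inE => /and3P[eH eF _]; apply/imset_injP; rewrite rF // rH.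
  - move=> e e'; rewrite !inE => /and3P[eH eF /existsPn h] /and3P[e'H _ _] ne eqc.
    by apply/eqP; have := h e'; rewrite e'H ne eqc eqxx !andbT negbK eq_sym.
suff [chi le_chi] : exists chi, #|H| * #|F| <= 2 * #|G chi| * n ^ r.
  by exists (G chi); split=> //; apply/subsetP => e; rewrite inE => /andP[].
apply: exists_ge_average; first by rewrite card_ffun card_ord expn_gt0 n_gt0.
rewrite card_ffun card_ord -mulnA.
pose X (e : {set V}) := #|[set chi : {ffun V -> 'I_n} | chi @: e \in F]|.
apply: (@leq_trans (\sum_(e in H) X e * n ^ r)).
  rewrite -sum_nat_const; apply: leq_sum => e eH.
  by have := @card_colourings_onto_edges r V 'I_n F e r_gt0 rF (rH _ eH); rewrite card_ord.
rewrite -!big_distrl leq_mul2r /=; apply/orP; right; rewrite -big_distrr /=.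
have sGH chi : G chi \subset H by apply/subsetP => e; rewrite inE => /andP[].
rewrite (double_count sGH).
rewrite big_distrr; apply: leq_sum => e eH /=.
have := @sum_colliding_colourings r n y V H F e rH y_gt0 len eH (deg e eH).
rewrite -/(X e); set T := \sum_(_ in _ | _) _ => leT.
set g := (Z in _ <= 2 * Z).
(* A colouring sending e into F either keeps e or has a collision at e. Collisions make up at most
   half of [X e], so at least half of these colourings keep e. *)
suff leg : X e <= g + T by rewrite mul2n -addnn; move: leT leg; lia.
pose U := \bigcup_(e' in H | (e' != e) && (e :&: e' != set0))
  [set chi : {ffun V -> 'I_n} | (chi @: e \in F) && (chi @: e == chi @: e')].
apply: (@leq_trans (g + #|U|)).
  apply: leq_trans (leq_card_setU _ _); apply: subset_leq_card; apply/subsetP => chi.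
  rewrite !inE eH /= => cF; rewrite cF /=; case: (boolP (bad chi e)) => //=.
  move=> /existsP[e' /and4P[e'H ne ni eqc]]; apply/bigcupP; exists e'.
    by rewrite e'H ne.
  by rewrite inE cF.
by rewrite leq_add2l; apply: leq_card_bigcup.
Qed.
(** * Merging heavy kernels *)

Lemma contraction (V : finType) (K : {set {set V}}) :
  (forall A B : {set V}, A \in K -> B \in K -> A :&: B != set0 -> A = B) ->
  exists rho : V -> V, [/\ forall A x, A \in K -> x \in A -> rho x \in A,
    forall A x y, A \in K -> x \in A -> y \in A -> rho x = rho y &
    forall x, (forall A, A \in K -> x \notin A) -> rho x = x].
Proof.
move=> disj.
pose blk x := [pick A in K | x \in A].
pose rho x := if blk x is Some A then odflt x [pick y in A] else x.
have blkE A x : A \in K -> x \in A -> blk x = Some A.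
  move=> AK xA; rewrite /blk; case: pickP => [B /andP[BK xB]|/(_ A)]; last by rewrite AK xA.
  by congr Some; apply: disj => //; apply/set0Pn; exists x; rewrite inE xB.
exists rho; split=> [A x AK xA|A x y AK xA yA|x out].
- by rewrite /rho (blkE A) //=; case: pickP => //= /(_ x); rewrite xA.
- by rewrite /rho !(blkE A) //=; case: pickP => //= /(_ x); rewrite xA.
- rewrite /rho /blk; case: pickP => // A /andP[AK xA].
  by have := out A AK; rewrite xA.
Qed.

(** By the last hypothesis the only kernel meeting an edge is its own. Merging turns i of its
    vertices into one and fixes the others, and the edge is a union of fibres. *)
Lemma contraction_kernels (r i : nat) (V : finType) (G : {set {set V}})
    (sigma : {set V} -> {set V}) :
  0 < i -> is_rgraph r G ->
  (forall e, e \in G -> sigma e \subset e) -> (forall e, e \in G -> #|sigma e| = i) ->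
  (forall e e', e \in G -> e' \in G -> sigma e' :&: e != set0 -> sigma e' = sigma e) ->
  exists rho : V -> V,
    (forall e, e \in G -> forall x y, x \in e -> rho y = rho x -> y \in e) /\
    is_rgraph (r - i).+1 [set rho @: (e : {set V}) | e in G].
Proof.
move=> i_gt0 rG sub szi loc; pose K := [set sigma e | e in G].
have disj (A B : {set V}) z : A \in K -> B \in K -> z \in A -> z \in B -> A = B.
  move=> /imsetP[e eG ->] /imsetP[e' e'G ->] ze ze'; apply: loc => //.
  by apply/set0Pn; exists z; rewrite inE ze (subsetP (sub _ e'G)).
have [|rho [rhoK rhoc rho_out]] := @contraction V K.
  by move=> A B AK BK /set0Pn[z]; rewrite inE => /andP[]; apply: disj.
have meetE e x A : e \in G -> x \in e -> A \in K -> x \in A -> A = sigma e.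
  move=> eG xe /imsetP[e' e'G ->] xA; apply: loc => //.
  by apply/set0Pn; exists x; rewrite inE xA.
have sK e : e \in G -> sigma e \in K by move=> eG; apply: imset_f.
have inK x : (exists2 A, A \in K & x \in A) \/ (forall A, A \in K -> x \notin A).
  case: (boolP [exists A in K, x \in A]) => [/exists_inP|/exists_inPn]; first by left.
  by right.
exists rho; split=> [e eG x y xe|_ /imsetP[e eG ->]].
  case: (inK y) (inK x) => [[B BK yB]|yout] [[A AK xA]|xout] eqxy.
  - have eA := meetE _ _ _ eG xe AK xA.
    have BA : B = A by apply: (disj _ _ (rho y)) => //; [exact: rhoK | rewrite eqxy rhoK].
    by rewrite (subsetP (sub _ eG)) // -eA -BA.
  - by have := xout B BK; rewrite -(rho_out x xout) -eqxy rhoK.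
  - rewrite -(rho_out y yout) eqxy (subsetP (sub _ eG)) //.
    by rewrite -(meetE _ _ _ eG xe AK xA) rhoK.
  - by rewrite -(rho_out y yout) eqxy rho_out.
have /card_gt0P[x0 x0e] : 0 < #|sigma e| by rewrite szi.
have out x : x \in e -> x \notin sigma e -> rho x = x.
  move=> xe xs; apply: rho_out => A AK; apply: contra xs => xA.
  by rewrite -(meetE _ _ _ eG xe AK xA).
have -> : rho @: e = rho x0 |: (e :\: sigma e).
  apply/setP => z; rewrite !inE; apply/imsetP/orP => [[x xe ->]|[/eqP->|/andP[zs ze]]].
  - case: (boolP (x \in sigma e)) => xs; [left|right; by rewrite out // xs].
    by rewrite (rhoc _ x x0 (sK _ eG)).
  - by exists x0 => //; apply: (subsetP (sub _ eG)).
  - by exists z => //; rewrite out.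
rewrite cardsU1 !inE rhoK ?sK //= cardsD (setIidPr (sub _ eG)) szi // rG //.
Qed.

Lemma codegree_sum (V : finType) (H : {set {set V}}) (S : {set V}) :
  codegree H S = \sum_(e in H) (S \subset e).
Proof.
rewrite /codegree -sum1_card big_mkcond [RHS]big_mkcond; apply: eq_bigr => e _.
by rewrite inE; case: (e \in H) => //=; case: (S \subset e).
Qed.

(** Count the pairs S, e with x in S and S inside e: each S occurs at least M times, each edge
    through x at most 2^r times. *)
Lemma heavy_sets_at_vertex (r M : nat) (V : finType) (H K : {set {set V}}) (x : V) :
  is_rgraph r H -> (forall S, S \in K -> M <= codegree H S) ->
  M * #|[set S in K | x \in S]| <= 2 ^ r * codegree H [set x].
Proof.
move=> rH heavy; rewrite mulnC -sum_nat_const.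
apply: (@leq_trans (\sum_(S in [set S in K | x \in S]) codegree H S)).
  by apply: leq_sum => S; rewrite inE => /andP[/heavy].
rewrite codegree_sum big_distrr.
rewrite [X in X <= _](eq_bigr (fun S : {set V} => \sum_(e in H) (S \subset e))); last first.
  by move=> S _; apply: codegree_sum.
rewrite exchange_big; apply: leq_sum => e eH /=; rewrite sub1set.
case: (boolP (x \in e)) => xe /=; last first.
  rewrite muln0 leqn0 big1 // => S; rewrite inE => /andP[_ xS].
  by case: (boolP (S \subset e)) => // /subsetP/(_ _ xS) xe'; rewrite xe' in xe.
rewrite muln1 -(rH _ eH) -card_powerset -sum1_card big_mkcond [X in _ <= X]big_mkcond /=.
by apply: leq_sum => S _; rewrite !inE; case: ifP => //; case: (S \subset e).
Qed.

(* A kernel is selected when it receives colour 0, so that the selection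
   events are pairwise independent. *)
Lemma sparse_kernels (r M D t : nat) (V : finType) (H H2 : {set {set V}})
    (sigma : {set V} -> {set V}) :
  0 < r -> 0 < M -> is_rgraph r H -> (forall x, codegree H [set x] <= D) ->
  H2 \subset H ->
  (forall e, e \in H2 -> [/\ sigma e \subset e, M <= codegree H (sigma e) &
     codegree H (sigma e) <= 2 * M]) ->
  4 * (r * 2 ^ r * D) <= M * t.+1 ->
  exists G : {set {set V}}, [/\ G \subset H2,
    forall e e', e \in G -> e' \in G -> sigma e' :&: e != set0 -> sigma e' = sigma e,
    forall e x, e \in G -> x \in e -> codegree G [set x] <= 12 * r * M &
    #|H2| <= 2 * t.+1 * #|G|].
Proof.
move=> r_gt0 M_gt0 rH degD sH2 hs let_.
pose C := {ffun {set V} -> 'I_t.+1}; pose K := [set sigma e | e in H2].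
pose Z (e : {set V}) := [set c : C | c (sigma e) == ord0].
pose deg (c : C) x := #|[set e in H2 | (x \in e) && (c (sigma e) == ord0)]|.
pose conf (e : {set V}) := [set S in K | (S != sigma e) && (S :&: e != set0)].
pose bad1 (e : {set V}) (c : C) := [exists S in conf e, c S == ord0].
(* The threshold is 4r times the bound 3M on the mean, so that Markov's inequality survives a union
   over the r vertices of e. *)
pose bad2 (e : {set V}) (c : C) := [exists x in e, 12 * r * M < deg c x].
pose G (c : C) := [set e in H2 | [&& c (sigma e) == ord0, ~~ bad1 e c & ~~ bad2 e c]].
have sGH c : G c \subset H2 by apply/subsetP => e; rewrite inE => /andP[].
suff [c lec] : exists c, #|H2| <= 2 * t.+1 * #|G c|.
  exists (G c); split=> // [e e'|e x].
    rewrite !inE => /and4P[eH ce /exists_inPn nb1 _] /and4P[e'H ce' _ _] ne.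
    apply/eqP; apply: contraTT ce' => neq; apply: nb1.
    by rewrite !inE neq ne imset_f.
  rewrite inE => /and4P[eH ce _ /exists_inPn nb2] xe.
  have := nb2 x xe; rewrite -leqNgt; apply: leq_trans; apply: subset_leq_card.
  by apply/subsetP => e'; rewrite !inE sub1set => /andP[/and4P[-> -> _ _] ->].
have cardZ e : #|Z e| * t.+1 = #|C|.
  have := card_ffun_constrained [set sigma e] (fun _ => [set ord0 : 'I_t.+1]).
  rewrite big_set1 cards1 mul1n cardsC1 card_ord card_ffun card_ord => cE.
  have -> : #|Z e| = t.+1 ^ #|{set V}|.-1.
    rewrite -cE; apply: eq_card => c; rewrite !inE; apply/eqP/forall_inP => [h S|h].
      by rewrite !inE => /eqP->; apply/eqP.
    by apply/eqP; have := h (sigma e); rewrite !inE eqxx; apply.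
  by rewrite -expnSr prednK //; apply/card_gt0P; exists set0.
have pair e S : S != sigma e -> #|[set c in Z e | c S == ord0]| * t.+1 <= #|Z e|.
  move=> neS; have agree (f g : C) : (forall v, v \notin [set S] -> f v = g v) ->
      f (sigma e) = g (sigma e).
    by apply; rewrite inE eq_sym.
  pose A (c : C) := [set ord0 : 'I_t.+1].
  pose Y := [set c in Z e | [forall S' in [set S], c S' \in A c]].
  have : #|Y| * #|'I_t.+1| ^ #|[set S]| <= 1 ^ #|[set S]| * #|Z e|.
    by apply: resample => // [f g /agree eqfg|f _]; rewrite ?cards1 // !inE eqfg.
  rewrite cards1 !expn1 mul1n card_ord.
  suff -> : #|[set c in Z e | c S == ord0]| = #|Y| by [].
  apply: eq_card => c; rewrite !inE; congr (_ && _).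
  apply/idP/forall_inP => [h S'|/(_ S)]; rewrite !inE; first by move=> /eqP->.
  by rewrite eqxx; apply.
have confM e : e \in H2 -> M * #|conf e| <= r * 2 ^ r * D.
  move=> eH; have re := rH e (subsetP sH2 _ eH).
  apply: (@leq_trans (\sum_(x in e) M * #|[set S in K | x \in S]|)).
    rewrite -big_distrr /= leq_mul2l; apply/orP; right.
    apply: leq_trans (leq_card_bigcup _ _); apply: subset_leq_card; apply/subsetP => S.
    rewrite !inE => /and3P[SK _ /set0Pn[x]]; rewrite inE => /andP[xS xe].
    by apply/bigcupP; exists x => //; rewrite inE SK.
  rewrite -mulnA -{1}re -sum_nat_const; apply: leq_sum => x xe.
  apply: leq_trans (heavy_sets_at_vertex _ rH _) _; last by rewrite leq_mul2l degD orbT.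
  by move=> _ /imsetP[e' e'H ->]; case: (hs e' e'H).
(* At most r 2^r D / M kernels conflict with e, each selected with conditional probability at most
   1/(t+1); the hypothesis on t makes the sum at most 1/4. *)
have prob1 e : e \in H2 -> 4 * #|[set c in Z e | bad1 e c]| <= #|Z e|.
  move=> eH; rewrite -(@leq_pmul2l (M * t.+1)) ?muln_gt0 ?M_gt0 //.
  apply: (@leq_trans (4 * (M * #|conf e|) * #|Z e|)); last first.
    by rewrite leq_mul2r; apply/orP; right; apply: leq_trans let_; rewrite leq_mul2l confM.
  rewrite mulnCA -!mulnA leq_mul2l; apply/orP; right; rewrite leq_mul2l; apply/orP; right.
  rewrite -sum_nat_const.
  apply: (@leq_trans (\sum_(S in conf e) t.+1 * #|[set c in Z e | c S == ord0]|)).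
    rewrite -big_distrr /= leq_mul2l; apply/orP; right.
    apply: leq_trans (leq_card_bigcup _ _); apply: subset_leq_card; apply/subsetP => c.
    rewrite !inE => /andP[ce /exists_inP[S Se cS]]; apply/bigcupP; exists S => //.
    by rewrite !inE ce.
  apply: leq_sum => S; rewrite inE => /and3P[_ neS _]; rewrite mulnC; exact: pair.
have prob2 e : e \in H2 -> 4 * #|[set c in Z e | bad2 e c]| <= #|Z e|.
  move=> eH; have re := rH e (subsetP sH2 _ eH).
  (* Mean degree of x given that e is selected: edges sharing the kernel of e contribute at most 2M,
     the others at most D/(t+1) <= M by pairwise independence. *)
  have mom x : x \in e -> \sum_(c in Z e) deg c x <= 3 * M * #|Z e|.
    move=> xe.
    have -> : \sum_(c in Z e) deg c x =
        \sum_(e' in H2 | x \in e') #|[set c in Z e | c (sigma e') == ord0]|.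
      rewrite (eq_bigr (fun c : C => \sum_(e' in H2 | x \in e') (c (sigma e') == ord0))).
        rewrite exchange_big; apply: eq_bigr => e' _.
        rewrite -sum1_card big_mkcond [RHS]big_mkcond; apply: eq_bigr => c _.
        by rewrite !inE; do 2 case: (_ == _).
      move=> c _; rewrite /deg -sum1_card big_mkcond [RHS]big_mkcond; apply: eq_bigr => e' _.
      by rewrite !inE; case: (e' \in H2) => //=; case: (x \in e') => //=; case: eqP.
    rewrite (bigID (fun e' => sigma e' == sigma e)) /=.
    have -> : 3 * M * #|Z e| = 2 * M * #|Z e| + M * #|Z e| by lia.
    apply: leq_add.
      apply: (@leq_trans (\sum_(e' in [set e' in H | sigma e \subset e']) #|Z e|)).
        rewrite big_mkcond [X in _ <= X]big_mkcond; apply: leq_sum => e' _.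
        case: ifP => // /andP[/andP[e'H xe'] /eqP eqs]; rewrite inE (subsetP sH2) //=.
        have [ss _ _] := hs e' e'H; rewrite -eqs ss; apply: subset_leq_card.
        by apply/subsetP => c; rewrite !inE => /andP[].
      by rewrite sum_nat_const leq_mul2r; have [_ _ ->] := hs e eH; rewrite orbT.
    rewrite -(@leq_pmul2r t.+1) // big_distrl /=.
    apply: (@leq_trans (\sum_(e' in [set e' in H | [set x] \subset e']) #|Z e|)).
      rewrite big_mkcond [X in _ <= X]big_mkcond; apply: leq_sum => e' _.
      case: ifP => // /andP[/andP[e'H xe'] neqs]; rewrite inE (subsetP sH2) //= sub1set xe'.
      exact: pair.
    rewrite sum_nat_const mulnAC leq_mul2r; apply/orP; right.
    apply: leq_trans (degD x) _; apply: leq_trans let_.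
    by rewrite mulnA leq_pmull // !muln_gt0 r_gt0 expn_gt0.
  have markov x : x \in e -> 4 * r * #|[set c in Z e | 12 * r * M < deg c x]| <= #|Z e|.
    move=> xe; rewrite -(@leq_pmul2l (3 * M)) ?muln_gt0 ?M_gt0 //.
    apply: leq_trans (mom x xe).
    apply: (@leq_trans (\sum_(c in [set c in Z e | 12 * r * M < deg c x]) 12 * r * M)).
      by rewrite sum_nat_const; set n := #|_|; lia.
    rewrite big_mkcond [X in _ <= X]big_mkcond; apply: leq_sum => c _.
    by rewrite !inE; case: ifP => // /andP[-> /ltnW].
  rewrite -(@leq_pmul2l r) // -{2}re -sum_nat_const.
  apply: (@leq_trans (\sum_(x in e) 4 * r * #|[set c in Z e | 12 * r * M < deg c x]|)).
    rewrite -big_distrr /= mulnA (mulnC r) leq_mul2l; apply/orP; right.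
    apply: leq_trans (leq_card_bigcup _ _); apply: subset_leq_card; apply/subsetP => c.
    rewrite !inE => /andP[ce /exists_inP[x xe cx]]; apply/bigcupP; exists x => //.
    by rewrite !inE ce.
  by apply: leq_sum => x; apply: markov.
apply: exists_ge_average; first by apply/card_gt0P; exists [ffun _ => ord0].
rewrite -big_distrr (double_count sGH) -sum_nat_const big_distrr /=.
apply: leq_sum => e eH; rewrite -(cardZ e) mulnC -mulnA mulnCA leq_mul2l; apply/orP; right.
have := prob1 e eH; have := prob2 e eH.
set g := #|[set _ | _ \in G _]|; set b1 := #|[set _ in _ | bad1 _ _]|.
set b2 := #|[set _ in _ | bad2 _ _]| => h2 h1.
(* Each kind of failure takes at most a quarter, so at least half of the colourings selecting the
   kernel of e keep e. *)
suff : #|Z e| <= g + (b1 + b2) by lia.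
apply: leq_trans
  (_ : g + #|[set c in Z e | bad1 e c] :|: [set c in Z e | bad2 e c]| <= _); last first.
  by rewrite leq_add2l leq_card_setU.
apply: leq_trans (leq_card_setU _ _); apply: subset_leq_card; apply/subsetP => c.
by rewrite !inE eH => -> /=; case: (bad1 e c) => //; case: (bad2 e c).
Qed.
Lemma codegreeS (V : finType) (H : {set {set V}}) (S S' : {set V}) :
  S \subset S' -> codegree H S' <= codegree H S.
Proof.
move=> sS; apply: subset_leq_card; apply/subsetP => e; rewrite !inE => /andP[->].
exact: subset_trans.
Qed.

Lemma imset_fibres_inj (V W : finType) (rho : V -> W) (G : {set {set V}}) :
  (forall e, e \in G -> forall x y, x \in e -> rho y = rho x -> y \in e) ->
  {in G &, injective (fun e : {set V} => rho @: e)}.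
Proof.
move=> fib; have sub (e e' : {set V}) : e' \in G -> rho @: e = rho @: e' -> e \subset e'.
  move=> e'G eqe; apply/subsetP => x xe.
  have /imsetP[y ye' eqxy] : rho x \in rho @: e' by rewrite -eqe imset_f.
  exact: (fib _ e'G y).
move=> e e' eG e'G eqe; apply/eqP; rewrite eqEsubset.
by rewrite (sub e e') // (sub e' e).
Qed.

(** Tameness composes: keep the edges whose image lies in G' and merge by [rho' \o rho]; their
    quotient is that of G'. *)
Lemma tame_contraction (l : nat) (V : finType) (rho : V -> V) (G G' : {set {set V}}) :
  (forall e, e \in G -> forall x y, x \in e -> rho y = rho x -> y \in e) ->
  G' \subset [set rho @: (e : {set V}) | e in G] -> tame l G' ->
  exists G0 : {set {set V}}, [/\ G0 \subset G, tame l G0 & #|G0| = #|G'|].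
Proof.
move=> fib sG' [rho' fib' cf]; pose G0 := [set e in G | rho @: e \in G'].
have sG0 : G0 \subset G by apply/subsetP => e; rewrite inE => /andP[].
have img : [set rho @: (e : {set V}) | e in G0] = G'.
  apply/setP => f; apply/imsetP/idP => [[e]|fG']; first by rewrite inE => /andP[_ eG'] ->.
  by have /imsetP[e eG eqf] := subsetP sG' f fG'; exists e; rewrite // inE eG -eqf.
exists G0; split=> //; last first.
  rewrite -img card_in_imset // => e e' /(subsetP sG0) eG /(subsetP sG0) e'G.
  exact: (imset_fibres_inj fib).
exists (rho' \o rho).
  move=> e; rewrite inE => /andP[eG eG'] x y xe /= /(fib' _ eG' _ _ (imset_f rho xe)).
  by case/imsetP=> z ze; apply: fib.
move: cf; rewrite -img -imset_comp.
by under eq_imset do rewrite /= -imset_comp.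
Qed.

(** An edge meeting the fibre of v contains all of it, so the edges through v come from edges
    through any one vertex of the fibre, and degrees do not add up. *)
Lemma codegree_contraction (theta : nat) (V : finType) (rho : V -> V) (G : {set {set V}}) :
  (forall e, e \in G -> forall x y, x \in e -> rho y = rho x -> y \in e) ->
  (forall e x, e \in G -> x \in e -> codegree G [set x] <= theta) ->
  forall v, codegree [set rho @: (e : {set V}) | e in G] [set v] <= theta.
Proof.
move=> fib deg v; rewrite /codegree.
have [->|[f]] := set_0Vmem [set e in [set rho @: (e : {set V}) | e in G] | [set v] \subset e].
  by rewrite cards0.
rewrite inE sub1set => /andP[/imsetP[e0 e0G ->] /imsetP[x xe0 ->]].
apply: leq_trans (deg e0 x e0G xe0).
apply: leq_trans (leq_imset_card (fun e : {set V} => rho @: e) _).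
apply: subset_leq_card; apply/subsetP => f'.
rewrite inE sub1set => /andP[/imsetP[e eG ->] /imsetP[y ye eqxy]].
by apply: imset_f; rewrite inE eG sub1set (fib _ eG _ _ ye).
Qed.

Lemma contract_heavy_kernels (r i M D : nat) (V : finType) (H H2 : {set {set V}})
    (sigma : {set V} -> {set V}) :
  0 < r -> 0 < i -> 0 < M -> is_rgraph r H -> (forall x, codegree H [set x] <= D) ->
  H2 \subset H ->
  (forall e, e \in H2 -> [/\ sigma e \subset e, #|sigma e| = i,
     M <= codegree H (sigma e) & codegree H (sigma e) <= 2 * M]) ->
  exists (G : {set {set V}}) (rho : V -> V), let G' := [set rho @: (e : {set V}) | e in G] in
  [/\ G \subset H2,
    forall e, e \in G -> forall x y, x \in e -> rho y = rho x -> y \in e,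
    is_rgraph (r - i).+1 G', forall v, codegree G' [set v] <= 12 * r * M &
    M * #|H2| <= 16 * r * 2 ^ r * D * #|G'|].
Proof.
move=> r_gt0 i_gt0 M_gt0 rH degD sH2 hs.
(* About D / M colours, times the constant that [sparse_kernels] asks for; the extra 1 rounds the
   quotient up. *)
pose t := (4 * r * 2 ^ r * (D %/ M).+1).-1.
have tE : t.+1 = 4 * r * 2 ^ r * (D %/ M).+1.
  by rewrite prednK // !muln_gt0 r_gt0 expn_gt0.
have [| |G [sG loc deg leG]] := @sparse_kernels r M D t V H H2 sigma r_gt0 M_gt0 rH degD sH2.
- by move=> e /hs[].
- have leD : D <= M * (D %/ M).+1 by rewrite mulnC ltnW // ltn_ceil.
  by rewrite tE (mulnC M) -!mulnA !leq_mul2l (mulnC _ M) leD !orbT.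
have rG : is_rgraph r G by move=> e /(subsetP sG)/(subsetP sH2); apply: rH.
have [| |rho [fib rG']] := @contraction_kernels r i V G sigma i_gt0 rG _ _ loc.
- by move=> e /(subsetP sG)/hs[].
- by move=> e /(subsetP sG)/hs[].
exists G, rho => /=; split=> //; first exact: codegree_contraction.
rewrite card_in_imset; last exact: imset_fibres_inj.
have [->|[e eH]] := set_0Vmem H2; first by rewrite cards0 muln0.
(* This bounds M (D / M + 1) by 2 D, turning the factor 8 into 16. *)
have leMD : M <= D.
  have [_ szi leM _] := hs e eH; apply: leq_trans leM _.
  have /card_gt0P[x xs] : 0 < #|sigma e| by rewrite szi.
  by apply: leq_trans (degD x); apply: codegreeS; rewrite sub1set.
apply: leq_trans (_ : M * (2 * t.+1 * #|G|) <= _); first by rewrite leq_mul2l leG orbT.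
rewrite !mulnA leq_mul2r; apply/orP; right; rewrite tE.
have := leq_divM D M; set q := D %/ M => leq.
have : (M * q.+1) * (8 * r * 2 ^ r) <= (2 * D) * (8 * r * 2 ^ r).
  by rewrite leq_mul2r; apply/orP; right; move: leq leMD; rewrite mulnS; lia.
by move: (2 ^ r) => p; lia.
Qed.

Lemma pigeonhole (T U : finType) (A : {set T}) (f : T -> U) : 0 < #|U| ->
  exists u, #|A| <= #|U| * #|[set x in A | f x == u]|.
Proof.
move=> U_gt0; apply: exists_ge_average => //.
rewrite -big_distrr mulnC leq_mul2l; apply/orP; right => /=.
rewrite -sum1_card (partition_big f xpredT) //=; apply: leq_sum => u _.
by rewrite sum1dep_card; apply: subset_leq_card; apply/subsetP => x; rewrite !inE.
Qed.

(** Each edge chooses one heavy subset. Size and dyadic scale of its codegree define at most r (log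
    D + 1) classes, and a large one is kept. Rounding down to 2^j costs the factor 2 in the
    heaviness bound. *)
Lemma heavy_class (r D : nat) (V : finType) (H Hh : {set {set V}}) :
  0 < D -> Hh != set0 -> (forall x, codegree H [set x] <= D) ->
  (forall e, e \in Hh -> exists S : {set V}, [/\ S \subset e, 1 < #|S| < r &
     D ^ (r - #|S|) < codegree H S ^ r.-1]) ->
  exists i j (H2 : {set {set V}}) (sigma : {set V} -> {set V}),
  [/\ 1 < i < r, H2 \subset Hh, D ^ (r - i) < (2 * 2 ^ j) ^ r.-1,
    forall e, e \in H2 -> [/\ sigma e \subset e, #|sigma e| = i,
     2 ^ j <= codegree H (sigma e) & codegree H (sigma e) <= 2 * 2 ^ j] &
    #|Hh| <= r * (trunc_log 2 D).+1 * #|H2|].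
Proof.
move=> D_gt0 /set0Pn[e0 e0H] degD heavy.
pose P (e S : {set V}) := [&& S \subset e, 1 < #|S| < r & D ^ (r - #|S|) < codegree H S ^ r.-1].
pose sigma e := odflt set0 [pick S | P e S].
have sigmaP e : e \in Hh -> P e (sigma e).
  move=> /heavy[S [h1 h2 h3]]; rewrite /sigma; case: pickP => //= /(_ S).
  by rewrite /P h1 h2 h3.
have r_gt0 : 0 < r by have /and3P[_ ? _] := sigmaP _ e0H; lia.
pose L := trunc_log 2 D.
(* [inord] loses nothing on [Hh]: the sizes are below r and the codegrees at most D. *)
pose f e : 'I_r.-1.+1 * 'I_L.+1 := (inord #|sigma e|, inord (trunc_log 2 (codegree H (sigma e)))).
have [|[i j]] := @pigeonhole _ _ Hh f; first by apply/card_gt0P; exists (ord0, ord0).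
rewrite card_prod !card_ord; set H2 := [set _ in _ | _]; rewrite prednK // => leH.
have codeg_gt0 e : e \in Hh -> 0 < codegree H (sigma e).
  move=> /sigmaP/and3P[_ /andP[s1 s2] big]; rewrite lt0n; apply: contraTneq big => ->.
  by rewrite -leqNgt exp0n //; lia.
have fE e : e \in H2 -> [/\ e \in Hh, #|sigma e| = i & trunc_log 2 (codegree H (sigma e)) = j].
  rewrite inE => /andP[eH /eqP eqf]; split=> //.
    have /and3P[_ /andP[_ ltr] _] := sigmaP e eH.
    by have := congr1 (fun p => val p.1) eqf; rewrite /= inordK // prednK.
  have /and3P[ss /andP[gt1 _] _] := sigmaP e eH.
  have := congr1 (fun p => val p.2) eqf; rewrite /= inordK // ltnS.
  apply: leq_trunc_log; have /card_gt0P[x xs] : 0 < #|sigma e| by apply: ltnW.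
  by apply: leq_trans (degD x); apply: codegreeS; rewrite sub1set.
have bnd e : e \in H2 -> 2 ^ j <= codegree H (sigma e) < 2 * 2 ^ j.
  by move=> /fE[eH _ <-]; rewrite -expnS; apply: trunc_log_bounds => //; apply: codeg_gt0.
exists i, j, H2, sigma.
have [e eH2] : exists e, e \in H2.
  apply/set0Pn; apply: contraTneq leH => ->; rewrite cards0 muln0 -ltnNge.
  by apply/card_gt0P; exists e0.
have [eH eqi eqj] := fE e eH2; have /and3P[ss lts big] := sigmaP e eH.
split=> //.
- by rewrite -eqi.
- by apply/subsetP => e1; rewrite inE => /andP[].
- rewrite -eqi; apply: leq_trans big _; have /andP[_ lt2] := bnd e eH2.
  have r1 : 0 < r.-1.
    by case/andP: lts => gt1 ltr; rewrite -ltnS prednK // (ltn_trans gt1).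
  by rewrite leq_exp2r // ltnW.
- move=> e1 e1H; have [e1Hh eq1 _] := fE e1 e1H; have /andP[b1 b2] := bnd e1 e1H.
  by have /and3P[ss1 _ _] := sigmaP e1 e1Hh; split=> //; apply: ltnW.
Qed.
(** * The upper bound: own pairs and the Moore bound *)

(* Otherwise every pair of vertices of e lies in another edge. Take e' <> e
   through u and v, then w in e outside e', then e'' <> e through v and w: the
   edges e, e', e'' form a Berge triangle with w in e and e'' but not in e'. *)
Lemma own_pair (l r : nat) (V : finType) (G : {set {set V}}) (e : {set V}) :
  2 < l -> 2 < r -> is_rgraph r G ->
  family_free (nonsunflower_berge_cycles_upto l r) G -> e \in G ->
  exists f : {set V}, [/\ #|f| = 2, f \subset e &
    forall e', e' \in G -> f \subset e' -> e' = e].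
Proof.
move=> l_gt2 r_gt2 rG fG eG; apply: contrapT => no_pair.
have shared x y : x \in e -> y \in e -> x != y ->
    exists e', [/\ e' \in G, e' != e, x \in e' & y \in e'].
  move=> xe ye neq; apply: contrapT => no_e'; apply: no_pair.
  exists [set x; y]; split; first by rewrite cards2 neq.
    by rewrite subUset !sub1set xe.
  move=> e' e'G; rewrite subUset !sub1set => /andP[xe' ye'].
  by apply/eqP/negPn/negP => ne; apply: no_e'; exists e'.
have re := rG e eG.
have /card_gt0P[u ue] : 0 < #|e| by rewrite re; lia.
have /card_gt0P[v] : 0 < #|e :\ u| by have := cardsD1 u e; rewrite re ue; lia.
rewrite !inE => /andP[vu ve].
have [e' [e'G ne' ve' ue']] := shared v u ve ue vu.
have /subsetPn[w we we'] : ~~ (e \subset e').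
  by apply: contra ne' => sub; rewrite eq_sym eqEcard sub re rG /=.
have vw : v != w by apply: contraNneq we' => <-.
have uw : u != w by apply: contraNneq we' => <-.
have [e'' [e''G ne'' ve'' we'']] := shared v w ve we vw.
have ne : e' != e'' by apply: contraNneq we' => ->.
pose s := [:: (w, e); (u, e'); (v, e'')].
have [||||||K hK] := @link_cycle_sunflower l r V G s rG fG _ _ _ _ _ _.
- by rewrite /= /link /= we ue ue' ve' ve'' we''.
- by rewrite /= !inE eq_sym (negbTE uw) eq_sym (negbTE vw) eq_sym (negbTE vu).
- by rewrite /= !inE negb_or (eq_sym e e') ne' (eq_sym e e'') ne'' ne.
- by move=> f; rewrite !inE => /or3P[]/eqP->.
- by [].
- by [].
have mem (f : {set V}) : f \in unzip2 s -> f \in [set f in unzip2 s] by rewrite in_set.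
rewrite eq_sym in ne'; rewrite eq_sym in ne''.
have eK : e :&: e' = K by apply: hK; rewrite // mem // !inE eqxx ?orbT.
have eK' : e :&: e'' = K by apply: hK; rewrite // mem // !inE eqxx ?orbT.
have : w \in e :&: e' by rewrite eK -eK' inE we.
by rewrite inE (negbTE we') andbF.
Qed.

(** * Non-backtracking walks and the Moore bound *)

Lemma leq_sum_card_disjoint (I T : finType) (A : {set I}) (B : I -> {set T}) :
  (forall i j z, i \in A -> j \in A -> z \in B i -> z \in B j -> i = j) ->
  \sum_(i in A) #|B i| <= #|\bigcup_(i in A) B i|.
Proof.
move=> disj; rewrite (eq_bigr (fun i => \sum_z (z \in B i))); last first.
  move=> i _; rewrite -sum1_card big_mkcond; apply: eq_bigr => z _.
  by case: (z \in B i).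
rewrite exchange_big -sum1_card [X in _ <= X]big_mkcond; apply: leq_sum => z _ /=.
case: (boolP (z \in _)) => [/bigcupP[i iA zi]|nz].
  rewrite (bigD1 i) //= zi big1 // => j /andP[jA ne]; apply/eqP; rewrite eqb0.
  by apply: contra ne => zj; rewrite (disj j i z).
rewrite big1 // => i iA; apply/eqP; rewrite eqb0; apply: contra nz => zi.
by apply/bigcupP; exists i.
Qed.

Definition other (V : finType) (x : V) (g : {set V}) : V := odflt x [pick y in g | y != x].

Lemma otherP (V : finType) (x : V) (g : {set V}) : #|g| = 2 -> x \in g ->
  other x g \in g /\ other x g != x.
Proof.
move=> g2 xg; rewrite /other; case: pickP => [y /andP[]//|no].
have : 0 < #|g :\ x| by have := cardsD1 x g; rewrite g2 xg; lia.
by case/card_gt0P=> y; rewrite !inE => /andP[yx yg]; have := no y; rewrite yg yx.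
Qed.

(* Endpoints of the non-backtracking walks of j + 1 steps that leave x along g. *)
Fixpoint walk_ends (V : finType) (E : {set {set V}}) (j : nat) (x : V) (g : {set V}) : {set V} :=
  if j is j'.+1 then
    \bigcup_(g' in [set g' in E | (other x g \in g') && (g' != g)])
      walk_ends E j' (other x g) g'
  else [set other x g].

Definition nb_step (V : finType) : rel (V * {set V}) :=
  [rel p q | link p q && step_neq p q].

(** Entries list departure vertices, so the end z appears only as a member of the last edge. *)
Lemma walk_forward (V : finType) (E : {set {set V}}) j x g z :
  is_rgraph 2 E -> g \in E -> x \in g -> z \in walk_ends E j x g ->
  exists s, [/\ size s = j, path (@nb_step V) (x, g) s,
    {subset unzip2 s <= E}, (last (x, g) s).1 \in (last (x, g) s).2 &
    z \in (last (x, g) s).2].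
Proof.
move=> gE; elim: j x g => [|j IHj] x g gE2 xg /=.
  by rewrite inE => /eqP->; exists [::]; split=> //; case: (otherP (gE _ gE2) xg).
have [og ox] := otherP (gE _ gE2) xg.
case/bigcupP=> g'; rewrite inE => /and3P[g'E og' ng'] /(IHj _ _ g'E og')[s [szs ps sub l1 l2]].
exists ((other x g, g') :: s); split=> //=; first by rewrite szs.
  by rewrite ps andbT /nb_step /link /step_neq /= xg og eq_sym ox eq_sym.
by move=> y; rewrite inE => /predU1P[->|/sub].
Qed.

(** The same walk read from z towards x, so that a forward walk from x can be appended. For j = 0
    the list [t] is empty and the default of [head] is z. *)
Lemma walk_backward (V : finType) (E : {set {set V}}) j x g z :
  is_rgraph 2 E -> g \in E -> x \in g -> z \in walk_ends E j x g ->
  exists t, [/\ size t = j, sorted (@nb_step V) (rcons t (other x g, g)),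
    {subset unzip2 t <= E} & (head (other x g, g) t).1 = z].
Proof.
move=> gE; elim: j x g => [|j IHj] x g gE2 xg /=.
  by rewrite inE => /eqP->; exists [::].
have [og ox] := otherP (gE _ gE2) xg.
case/bigcupP=> g'; rewrite inE => /and3P[g'E og' ng'] /(IHj _ _ g'E og')[t [szt st sub hz]].
have [og2 ox2] := otherP (gE _ g'E) og'.
exists (rcons t (other (other x g) g', g')); split; first by rewrite size_rcons szt.
- case: t szt st sub hz => [|q t] /= szt st sub hz.
    by rewrite /nb_step /link /step_neq /= og2 og' ox2 ng'.
  rewrite rcons_path st /= last_rcons.
  by rewrite /nb_step /link /step_neq /= og2 og' ox2 ng'.
- move=> y; rewrite /unzip2 map_rcons mem_rcons inE => /predU1P[->//|]; exact: sub.
- by case: t szt st sub hz.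
Qed.

(** Otherwise go from z back to x through g and on to z through g'. This closed walk turns properly
    at x since g and g' differ, may backtrack only at its seam z, and has 2(j+1) <= 2k steps, so it
    yields a forbidden cycle. *)
Lemma walk_ends_disjoint (k j : nat) (V : finType) (E : {set {set V}}) x g g' z :
  is_rgraph 2 E -> cycle_free (2 * k) E -> j < k -> g \in E -> g' \in E ->
  x \in g -> x \in g' -> z \in walk_ends E j x g -> z \in walk_ends E j x g' -> g = g'.
Proof.
move=> E2 cf ltjk gE g'E xg xg' zg zg'; apply/eqP/negPn/negP => ne.
have [t [szt st subt hz]] := walk_backward E2 gE xg zg.
have [s [szs ps subs l1 l2]] := walk_forward E2 g'E xg' zg'.
have [og ox] := otherP (E2 _ gE) xg.
pose c := rcons t (other x g, g) ++ (x, g') :: s.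
have szc : size c = 2 * j.+1 by rewrite size_cat size_rcons /= szt szs mul2n -addnn.
have sc : sorted (@nb_step V) c.
  rewrite /c; case: t szt st subt hz {c szc} => [|q t] /= szt st subt hz.
    by rewrite ps /nb_step /link /step_neq /= og xg ox ne.
  rewrite cat_path st /= last_rcons ps.
  by rewrite /nb_step /link /step_neq /= og xg ox ne.
move: (sc); rewrite sorted_relI => /andP[lc nc].
have cc : cycle (@link V) c.
  case def_c : c szc lc => [//|q c'] szc lc.
  rewrite /= rcons_path; move: lc => /= ->.
  have -> : last q c' = last (x, g') s.
    by rewrite -[last q c']/(last q (q :: c')) -def_c /c last_cat.
  have -> : q = head (other x g, g) c by rewrite def_c.
  rewrite /link l1 /c; case: (t) hz => [|a t'] /= ->; exact: l2.
have [|t' [ct' u1 u2 sub /andP[t'_gt1 let']]] := nonbacktracking_cycle cc nc.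
  by rewrite szc mul2n -addnn addSn ltnS addnS.
have subE : {subset unzip2 t' <= E}.
  move=> y /sub; rewrite /c /unzip2 map_cat map_rcons mem_cat mem_rcons !inE /=.
  by case/orP=> /predU1P[->//|]; [apply: subt|apply: subs].
have /negP[] := cf t' ct' u1 u2 subE t'_gt1.
by rewrite (leq_trans let') // szc leq_mul2l.
Qed.

(** At each arrival more than d edges are available, one of them just used, and the sets reached
    through the others are disjoint. *)
Lemma card_walk_ends (k d j : nat) (V : finType) (E : {set {set V}}) x g :
  is_rgraph 2 E -> cycle_free (2 * k) E ->
  (forall f y, f \in E -> y \in f -> d < codegree E [set y]) ->
  j < k -> g \in E -> x \in g -> d ^ j <= #|walk_ends E j x g|.
Proof.
move=> E2 cf deg; elim: j x g => [|j IHj] x g ltjk gE xg /=; first by rewrite cards1.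
have [og ox] := otherP (E2 _ gE) xg.
apply: leq_trans (leq_sum_card_disjoint _); last first.
  move=> g1 g2 z; rewrite !inE => /and3P[g1E o1 _] /and3P[g2E o2 _].
  by apply: (walk_ends_disjoint E2 cf (ltnW ltjk)).
apply: (@leq_trans (\sum_(g' in [set g' in E | (other x g \in g') && (g' != g)]) d ^ j)).
  rewrite sum_nat_const expnS leq_mul2r; apply/orP; right.
  have := deg g _ gE og; rewrite /codegree (cardsD1 g) inE gE sub1set og ltnS.
  move/leq_trans; apply; apply: subset_leq_card; apply/subsetP => g'.
  by rewrite !inE sub1set => /and3P[-> -> ->].
by apply: leq_sum => g'; rewrite inE => /and3P[g'E og' _]; apply: IHj => //; apply: ltnW.
Qed.

(** Delete a vertex of degree below d as long as there is one; the invariant d |W| <= e(W) survives,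
    even strictly. *)
Lemma min_degree_subgraph (d : nat) (V : finType) (E : {set {set V}}) :
  is_rgraph 2 E -> 0 < #|V| -> d * #|V| <= #|E| ->
  exists W : {set V}, W != set0 /\
    forall y, y \in W -> d <= codegree [set f in E | f \subset W] [set y].
Proof.
move=> E2 V_gt0; rewrite -cardsT => leE.
pose ind (W : {set V}) := [set f in E | f \subset W].
have : d * #|[set: V]| <= #|ind setT|.
  by apply: leq_trans leE _; apply: subset_leq_card; apply/subsetP => f; rewrite inE subsetT andbT.
have : [set: V] != set0 by rewrite -card_gt0 cardsT.
have [n] := ubnP #|[set: V]|; elim: n [set: V] => // n IHn W leW Wn0 dW.
case: (boolP [exists y in W, codegree (ind W) [set y] < d]); last first.
  move=> /exists_inPn h.
  by exists W; split=> // y /h; rewrite -leqNgt.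
move=> /exists_inP[y yW degy].
have cW : #|W| = #|W :\ y|.+1 by rewrite (cardsD1 y) yW.
have leI : #|ind W| <= #|ind (W :\ y)| + codegree (ind W) [set y].
  apply: leq_trans (leq_card_setU _ _); apply: subset_leq_card; apply/subsetP => f.
  rewrite !inE sub1set subsetD1 => /andP[-> ->] /=.
  by case: (y \in f); rewrite ?orbT.
have dWy : d * #|W :\ y| < #|ind (W :\ y)|.
  by move: dW; rewrite cW mulnS; move: leI degy; clear; lia.
apply: (IHn (W :\ y)).
- by move: leW; rewrite cW ltnS.
(* The strict inequality leaves an edge, which needs vertices, so the smaller set is nonempty. *)
- apply: contraTneq dWy => W0; rewrite -leqNgt (_ : ind _ = set0) ?cards0 //.
  apply/setP => f; rewrite !inE W0 subset0; apply/negP => /andP[fE /eqP f0].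
  by have := E2 f fE; rewrite f0 cards0.
- exact: ltnW.
Qed.

(** From a vertex of a subgraph of minimum degree d + 1, more than d first edges each lead to at
    least d^(k-1) endpoints, and different first edges reach disjoint sets. *)
Lemma graph_moore_bound (k d : nat) (V : finType) (E : {set {set V}}) :
  is_rgraph 2 E -> cycle_free (2 * k) E -> 0 < #|V| -> d.+1 * #|V| <= #|E| ->
  d ^ k <= #|V|.
Proof.
case: k => [|k] E2 cf V_gt0 leE; first by rewrite expn0.
have [W [/set0Pn[x xW] deg]] := min_degree_subgraph E2 V_gt0 leE.
set E' := [set f in E | f \subset W] in deg.
have sE' : E' \subset E by apply/subsetP => f; rewrite inE => /andP[].
have E2' : is_rgraph 2 E' by move=> f /(subsetP sE'); apply: E2.
have cf' : cycle_free (2 * k.+1) E'.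
  by move=> s cs u1 u2 sub; apply: cf => // y /sub/(subsetP sE').
have deg' f y : f \in E' -> y \in f -> d < codegree E' [set y].
  by rewrite inE => /andP[_ /subsetP sfW] /sfW/deg.
apply: leq_trans (max_card (mem (\bigcup_(g in [set g in E' | x \in g]) walk_ends E' k x g))).
apply: leq_trans (leq_sum_card_disjoint _); last first.
  move=> g1 g2 z; rewrite !inE -!andbA => /and3P[g1E o1 g1x] /and3P[g2E o2 g2x].
  by apply: (walk_ends_disjoint E2' cf'); rewrite // inE ?g1E ?g2E.
apply: (@leq_trans (\sum_(g in [set g in E' | x \in g]) d ^ k)); last first.
  by apply: leq_sum => g; rewrite inE => /andP[gE xg]; apply: (@card_walk_ends k.+1).
rewrite sum_nat_const expnS leq_mul2r; apply/orP; right.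
apply: leq_trans (ltnW (deg x xW)) _; apply: subset_leq_card; apply/subsetP => g.
by rewrite !inE sub1set.
Qed.

(** Replacing own pairs by their edges turns a short cycle into a Berge cycle of G, hence a
    sunflower. Both vertices of the first pair then lie in the kernel, so in the second edge too,
    against ownership. *)
Lemma own_pair_graph (l r : nat) (V : finType) (G : {set {set V}}) :
  2 < l -> 2 < r -> is_rgraph r G ->
  family_free (nonsunflower_berge_cycles_upto l r) G ->
  exists E : {set {set V}}, [/\ is_rgraph 2 E, cycle_free l E & #|E| = #|G|].
Proof.
move=> l_gt2 r_gt2 rG fG.
pose P (e f : {set V}) :=
  [&& #|f| == 2, f \subset e & [forall e' in G, (f \subset e') ==> (e' == e)]].
pose p e := odflt set0 [pick f | P e f].
have pP e : e \in G -> P e (p e).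
  move=> eG; have [f [f2 fe own]] := own_pair l_gt2 r_gt2 rG fG eG.
  rewrite /p; case: pickP => //= /(_ f); rewrite /P f2 fe /= => /forall_inP[].
  by move=> e' e'G; apply/implyP => /(own e' e'G)->.
have own e e' : e \in G -> e' \in G -> p e \subset e' -> e' = e.
  by move=> /pP/and3P[_ _ /forall_inP h] e'G; have /implyP h' := h e' e'G; move=> /h'/eqP.
have sub e : e \in G -> p e \subset e by move=> /pP/and3P[].
have inj : {in G &, injective p}.
  by move=> e e' eG e'G eqp; apply: own => //; rewrite -eqp; apply: sub.
exists [set p e | e in G]; split; last exact: card_in_imset.
  by move=> _ /imsetP[e /pP/and3P[/eqP h _ _] ->].
move=> s cs u1 u2 subs s_gt1; apply/negP => s_lel.
pose h f := odflt set0 [pick e in G | p e == f].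
have hP f : f \in [set p e | e in G] -> h f \in G /\ p (h f) = f.
  move=> /imsetP[e eG eqf]; rewrite /h; case: pickP => /= [e' /andP[e'G /eqP]//|/(_ e)].
  by rewrite eG eqf eqxx.
have memE q : q \in s -> q.2 \in [set p e | e in G] by move=> qs; apply/subs/map_f.
pose s' := [seq (q.1, h q.2) | q <- s].
have u1' : unzip1 s' = unzip1 s by rewrite /unzip1 -map_comp.
have u2' : unzip2 s' = map h (unzip2 s) by rewrite /unzip2 -!map_comp.
have hsub q x : q \in s -> x \in q.2 -> x \in h q.2.
  by move=> /memE/hP[hG {1}<-] xp; apply: (subsetP (sub _ hG)).
have [||||||K hK] := @link_cycle_sunflower l r V G s' rG fG _ _ _ _ _ _.
- rewrite cycle_map; apply: (sub_in_cycle (P := mem s)) cs; last exact/allP.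
  by move=> q1 q2 q1s q2s /andP[h1 h2]; rewrite /= /link /= !hsub.
- by rewrite u1'.
- rewrite u2' map_inj_in_uniq // => f f' /subs/hP[_ e1] /subs/hP[_ e2] eqh.
  by rewrite -e1 eqh e2.
- by move=> e; rewrite u2' => /mapP[f /subs/hP[hG _] ->].
- by rewrite size_map.
- by rewrite size_map.
case: s cs u1 u2 subs s_gt1 s_lel memE @s' u1' u2' hsub hK => [|q0 [|q1 s]] //.
move=> cs u1 u2 subs _ _ memE s' u1' u2' hsub hK.
have inS q : q \in [:: q0, q1 & s] -> h q.2 \in [set e in unzip2 s'].
  by move=> qs; rewrite inE u2'; apply/map_f/map_f.
have hinj q q' : q \in [:: q0, q1 & s] -> q' \in [:: q0, q1 & s] -> q.2 != q'.2 -> h q.2 != h q'.2.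
  move=> /memE/hP[_ eq1] /memE/hP[_ eq2]; apply: contra => /eqP eqh.
  by rewrite -eq1 eqh eq2.
(* The predecessor of [q0] around the cycle; it is [q1] itself when the cycle has length 2. *)
pose ql := last q1 s.
have q0s : q0 \in [:: q0, q1 & s] by rewrite inE eqxx.
have q1s : q1 \in [:: q0, q1 & s] by rewrite !inE eqxx orbT.
have qls : ql \in [:: q0, q1 & s] by rewrite inE mem_last orbT.
have q01 : q0.2 != q1.2 by move: u2; rewrite /= inE negb_or => /andP[/andP[]].
have q0l : q0.2 != ql.2.
  move: u2 => /= /andP[+ _]; apply: contra => /eqP->; apply: (map_f snd (mem_last q1 s)).
have lkl : link ql q0 by move: cs; rewrite /= rcons_path => /and3P[].
have /andP[q00 q10] : link q0 q1 by move: cs => /= /andP[].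
have q11 := cycle_link_mem cs q1s.
have q0K : q0.1 \in K.
  rewrite -(hK _ _ (inS _ q0s) (inS _ qls) (hinj _ _ q0s qls q0l)) inE !hsub //.
  by case/andP: lkl.
have q1K : q1.1 \in K.
  by rewrite -(hK _ _ (inS _ q0s) (inS _ q1s) (hinj _ _ q0s q1s q01)) inE !hsub.
have q0E : q0.2 = [set q0.1; q1.1].
  apply/esym/eqP; rewrite eqEcard subUset !sub1set q00 q10 cards2.
  have -> : q0.1 != q1.1 by move: u1; rewrite /= inE negb_or => /andP[/andP[]].
  by have [hG eqp] := hP _ (memE _ q0s); rewrite -eqp; have /and3P[/eqP-> _ _] := pP _ hG.
have [hG0 p0] := hP _ (memE _ q0s); have [hG1 _] := hP _ (memE _ q1s).
have /eqP[] := hinj _ _ q0s q1s q01; apply/esym/own => //.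
rewrite p0 q0E; apply: (@subset_trans _ _ (mem K)).
  by rewrite subUset !sub1set q0K.
rewrite -(hK _ _ (inS _ q0s) (inS _ q1s) (hinj _ _ q0s q1s q01)); exact: subsetIr.
Qed.

Lemma cycle_freeW (l l' : nat) (V : finType) (G : {set {set V}}) :
  l' <= l -> cycle_free l G -> cycle_free l' G.
Proof.
move=> lel cf s cs u1 u2 sub s_gt1; have := cf s cs u1 u2 sub s_gt1.
by apply: contra => /leq_trans; apply.
Qed.

Lemma turan_nonsunflower_bound (l r n : nat) (H : {set {set 'I_n}}) :
  2 < l -> 2 < r -> is_rgraph r H -> 0 < n ->
  exists d, d ^ (l %/ 2) <= n /\
    turan (nonsunflower_berge_cycles_upto l r) H <= d.+2 * n.
Proof.
move=> l_gt2 r_gt2 rH n_gt0.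
have [G [sG [->|fG] <-]] := turan_attained (nonsunflower_berge_cycles_upto l r) H.
  by exists 0; rewrite cards0 exp0n // divn_gt0 //; apply: ltnW.
have rG : is_rgraph r G by move=> e /(subsetP sG)/rH.
have [E [E2 cf <-]] := own_pair_graph l_gt2 r_gt2 rG fG.
have [small|big] := ltnP #|E| n.
  exists 0; rewrite exp0n ?divn_gt0 ?(ltnW l_gt2) //; split=> //.
  by apply: (leq_trans (ltnW small)); rewrite leq_pmull.
(* The Moore bound needs (d + 1) n <= |E|, hence the predecessor; rounding the quotient up gives |E|
   <= (d + 2) n. *)
exists (#|E| %/ n).-1; have q_gt0 : 0 < #|E| %/ n by rewrite divn_gt0.
split; last by rewrite prednK // ltnW // ltn_ceil.
have := @graph_moore_bound (l %/ 2) (#|E| %/ n).-1 'I_n E E2.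
rewrite card_ord prednK // leq_divM n_gt0 mulnC; apply=> //.
by apply: cycle_freeW cf; rewrite leq_divM.
Qed.
(** * Exponents *)

(** Keep r' >= 2 vertices of each edge. Equal truncations would mean two shared vertices, a Berge
    2-cycle, so no edge is lost; a cycle of truncated edges lifts to the full ones. *)
Lemma shrink_uniform (l r r' : nat) (V : finType) (G : {set {set V}}) :
  1 < l -> 1 < r' <= r -> is_rgraph r G -> cycle_free l G ->
  exists G' : {set {set V}}, [/\ is_rgraph r' G', cycle_free l G' & #|G'| = #|G|].
Proof.
move=> l_gt1 /andP[r'_gt1 ler] rG cf.
pose p (e : {set V}) := [set x in take r' (enum e)].
have psub e : p e \subset e by apply/subsetP => x; rewrite inE => /mem_take; rewrite mem_enum.
have pcard e : e \in G -> #|p e| = r'.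
  move=> eG; rewrite cardsE (card_uniqP _) ?take_uniq ?enum_uniq // size_take -cardE rG //.
  by case: ltngtP ler.
have inj : {in G &, injective p}.
  move=> e e' eG e'G eqp; apply/eqP/negPn/negP => ne.
  have /card_gt0P[x xp] : 0 < #|p e| by rewrite pcard // ltnW.
  have /card_gt0P[y] : 0 < #|p e :\ x| by have := cardsD1 x (p e); rewrite pcard // xp; lia.
  rewrite in_setD1 => /andP[yx yp].
  have mem z : z \in p e -> (z \in e) && (z \in e').
    by move=> zp; rewrite (subsetP (psub e)) // (subsetP (psub e')) // -eqp.
  have /andP[xe xe'] := mem x xp; have /andP[ye ye'] := mem y yp.
  have := cf [:: (x, e); (y, e')]; rewrite /= /link /= xe ye xe' ye' !inE ne eq_sym yx l_gt1.
  move=> /(_ isT isT isT) h; apply: notF; apply: h => // f.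
  by rewrite !inE => /orP[]/eqP->.
exists [set p e | e in G]; split; last exact: card_in_imset.
  by move=> _ /imsetP[e eG ->]; apply: pcard.
move=> s cs u1 u2 subs s_gt1; apply/negP => s_lel.
pose h f := odflt set0 [pick e in G | p e == f].
have hP f : f \in [set p e | e in G] -> h f \in G /\ p (h f) = f.
  move=> /imsetP[e eG eqf]; rewrite /h; case: pickP => /= [e' /andP[e'G /eqP]//|/(_ e)].
  by rewrite eG eqf eqxx.
pose s' := [seq (q.1, h q.2) | q <- s].
have u1' : unzip1 s' = unzip1 s by rewrite /unzip1 -map_comp.
have u2' : unzip2 s' = map h (unzip2 s) by rewrite /unzip2 -!map_comp.
have hsub q x : q \in s -> x \in q.2 -> x \in h q.2.
  by move=> /(map_f snd)/subs/hP[hG {1}<-] xp; apply: (subsetP (psub _)).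
have [|||||] := negP (cf s' _ _ _ _ _).
- rewrite cycle_map; apply: (sub_in_cycle (P := mem s)) cs; last exact/allP.
  by move=> q1 q2 q1s q2s /andP[h1 h2]; rewrite /= /link /= !hsub.
- by rewrite u1'.
- rewrite u2' map_inj_in_uniq // => f f' /subs/hP[_ e1] /subs/hP[_ e2] eqh.
  by rewrite -e1 eqh e2.
- by move=> e; rewrite u2' => /mapP[f /subs/hP[hG _] ->].
- by rewrite size_map.
- by rewrite size_map.
Qed.

Local Open Scope ring_scope.

Lemma le_powR_base (R : realType) (a b x : R) : 0 <= a -> a <= b -> 0 <= x -> a `^ x <= b `^ x.
Proof.
by move=> a0 ab x0; apply: ge0_ler_powR => //; rewrite nnegrE // (le_trans a0).
Qed.

Lemma ge_powR_base (R : realType) (a b x : R) : 0 < a -> a <= b -> x <= 0 -> b `^ x <= a `^ x.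
Proof.
move=> a0 ab x0; have b0 : 0 < b by apply: lt_le_trans ab.
rewrite -[x]opprK !(powRN _ (- x)) lef_pV2 ?posrE ?powR_gt0 //.
by apply: le_powR_base => //; [exact: ltW | rewrite oppr_ge0].
Qed.

(** The exponent [a] of n is nonpositive, so n may be replaced by its upper bound. Dividing [a] by r
    - 1 gives -1 + 1/((r-1)k) - eps/(r-1), which is at least the target exponent. *)
Lemma colouring_density_exponent (R : realType) (r k : nat) (C D n eps : R) :
  (1 < r)%N -> (0 < k)%N -> 0 < eps -> 1 <= D -> 0 < C -> 0 < n ->
  n <= C * D `^ (1 / (r - 1)%:R) ->
  C `^ (1 + 1 / k%:R - eps - r%:R) * D `^ (- 1 + 1 / ((r - 1) * k)%:R - eps)
    <= n `^ (1 + 1 / k%:R - eps) / n ^+ r.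
Proof.
move=> r_gt1 k_gt0 eps_gt0 D_ge1 C_gt0 n_gt0 len.
set a := 1 + 1 / k%:R - eps - r%:R.
have m_ge1 : 1 <= (r - 1)%:R :> R by rewrite ler1n subn_gt0.
have k_ge1 : 1 <= k%:R :> R by rewrite ler1n.
have rE : r%:R = (r - 1)%:R + 1 :> R by rewrite natrB ?subrK // ltnW.
have kV : 1 / k%:R <= 1 :> R by rewrite ler_pdivrMr ?mul1r //; lra.
have a_le0 : a <= 0 by rewrite /a rE; lra.
rewrite -powR_mulrn ?(ltW n_gt0) // -powRB -/a; last by apply/implyP => _; rewrite gt_eqF.
apply: le_trans (ge_powR_base n_gt0 len a_le0).
rewrite powRM ?powR_ge0 ?(ltW C_gt0) // ler_wpM2l ?powR_ge0 // -powRrM.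
apply: ler_powR => //; rewrite natrM /a rE; set m := (r - 1)%:R.
have -> : 1 / m * (1 + 1 / k%:R - eps - (m + 1)) = - 1 + 1 / (m * k%:R) - eps / m.
  field; apply/andP; split; rewrite gt_eqF //; first exact: lt_le_trans m_ge1.
  exact: lt_le_trans k_ge1.
by rewrite lerD2l lerN2 ler_pdivrMr ?ler_peMr ?(ltW eps_gt0) //; apply: lt_le_trans m_ge1.
Qed.

(** exp x >= 1 + x, applied to (2^L)^eps = exp(eps L ln 2), beats a linear function of L. This
    absorbs the number of dyadic classes. *)
Lemma trunc_log_le_powR (R : realType) (eps : R) : 0 < eps ->
  exists2 c : R, 0 < c & forall D : nat, (0 < D)%N ->
    c * (trunc_log 2 D).+1%:R <= D%:R `^ eps.
Proof.
move=> eps_gt0; pose u : R := eps * ln 2.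
have u_gt0 : 0 < u by rewrite mulr_gt0 // ln_gt0 // ltr1n.
exists (Num.min 1 u); first by rewrite lt_min ltr01.
move=> D D_gt0; set L := trunc_log 2 D.
have leD : (2 ^ L)%:R <= D%:R :> R.
  by rewrite ler_nat; have /andP[] := @trunc_log_bounds 2 D isT D_gt0.
apply: le_trans (le_powR_base _ leD (ltW eps_gt0)); last by rewrite ler0n.
apply: (@le_trans _ _ (1 + u * L%:R)).
  rewrite -natr1 mulrDr mulr1 addrC lerD ?ge_min ?lexx // ler_wpM2r ?ler0n //.
  by rewrite ge_min lexx orbT.
have -> : (2 ^ L)%:R `^ eps = expR (u * L%:R).
  rewrite /powR pnatr_eq0 expn_eq0 /= natrX lnXn // /u.
  by congr expR; rewrite -[ln 2 *+ L]mulr_natr mulrA.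
exact: expR_ge1Dx.
Qed.

(** Taking roots in the heaviness bound, M^(1/((r-i)k)) is at least D^(1/((r-1)k)) up to the factor
    2^q <= 2, and M^(-eps) >= D^(-eps) as M <= D. [A] stands for the constant in the degree bound A
    M after merging. *)
Lemma merging_exponent (R : realType) (r i k D M : nat) (A eps : R) :
  (i < r)%N -> (1 < i)%N -> (0 < k)%N -> 0 < eps -> 1 <= A -> (0 < M <= D)%N ->
  (D ^ (r - i) <= (2 * M) ^ (r - 1))%N ->
  2^-1 * A `^ (- 1 - eps) * D%:R `^ (1 / ((r - 1) * k)%:R - eps)
    <= (A * M%:R) `^ (- 1 + 1 / ((r - i) * k)%:R - eps) * M%:R.
Proof.
move=> ltir i_gt1 k_gt0 eps_gt0 A_ge1 /andP[M_gt0 leMD] leD.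
have A_gt0 : 0 < A by apply: lt_le_trans A_ge1.
have D_gt0 : (0 < D)%N by apply: leq_trans leMD.
have MR : 0 < M%:R :> R by rewrite ltr0n.
have DR : 0 < D%:R :> R by rewrite ltr0n.
set q := 1 / ((r - i) * k)%:R.
have q_ge0 : 0 <= q by rewrite divr_ge0 ?ler0n.
have q_le1 : q <= 1.
  by rewrite ler_pdivrMr ?mul1r ?ltr0n ?ler1n muln_gt0 subn_gt0 ltir k_gt0.
have h1 : A `^ (- 1 - eps) <= A `^ (- 1 + q - eps) by apply: ler_powR => //; lra.
have h2 : 2^-1 * D%:R `^ (1 / ((r - 1) * k)%:R - eps) <= M%:R `^ (- 1 + q - eps) * M%:R.
  rewrite -{2}[M%:R](powRr1 (ltW MR)) -powRD; last by apply/implyP => _; rewrite gt_eqF.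
  have -> : - 1 + q - eps + 1 = q - eps by lra.
  rewrite !powRB; try by apply/implyP => _; rewrite gt_eqF.
  rewrite mulrA; apply: ler_pM;
    rewrite ?invr_ge0 ?powR_ge0 ?mulr_ge0 ?invr_ge0 ?powR_ge0 //; last first.
    by rewrite lef_pV2 ?posrE ?powR_gt0 // le_powR_base ?ler_nat ?(ltW eps_gt0).
  rewrite mulrC ler_pdivrMr ?ltr0n //.
  have MM : 0 <= (2 * M)%:R :> R by apply: ler0n.
  apply: (@le_trans _ _ ((2 * M)%:R `^ q)); last first.
    rewrite natrM powRM ?ler0n // mulrC ler_wpM2l ?powR_ge0 //.
    by apply: ler1_powR; rewrite ?ler1n.
  have r1 : (r - 1)%:R != 0 :> R by rewrite pnatr_eq0 subn_eq0 -ltnNge (ltn_trans i_gt1).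
  have ri : (r - i)%:R != 0 :> R by rewrite pnatr_eq0 subn_eq0 -ltnNge.
  have k0 : k%:R != 0 :> R by rewrite pnatr_eq0 -lt0n.
  have -> : 1 / ((r - 1) * k)%:R = (r - i)%:R * (1 / ((r - 1) * ((r - i) * k))%:R) :> R.
    by rewrite !natrM; field; rewrite r1 ri k0.
  have -> : q = (r - 1)%:R * (1 / ((r - 1) * ((r - i) * k))%:R) :> R.
    by rewrite /q !natrM; field; rewrite r1 ri k0.
  have z_ge0 : 0 <= 1 / ((r - 1) * ((r - i) * k))%:R :> R by rewrite divr_ge0 ?ler0n.
  move: z_ge0; set z := 1 / _ => z_ge0.
  rewrite (powRrM D%:R) (powRrM (2 * M)%:R) !powR_mulrn ?ler0n //.
  apply: le_powR_base => //.
  by rewrite -(natrX _ D) -(natrX _ (2 * M)) ler_nat.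
rewrite powRM ?(ltW A_gt0) ?ler0n // -!mulrA mulrCA.
apply: ler_pM; rewrite ?powR_ge0 ?mulr_ge0 ?invr_ge0 ?powR_ge0 //.
Qed.

(** * The lower bound by induction on the uniformity *)

Lemma extremal_uniform_graphs (R : realType) (l r : nat) :
  (1 < l)%N ->
  (forall eps : R, 0 < eps -> exists n0 : nat, forall n : nat, (n0 <= n)%N ->
     n%:R `^ (1 + 1 / (l %/ 2)%:R - eps)
       <= (turan (berge_cycles_upto l r) (complete_rgraph r n))%:R) ->
  forall (r' : nat) (eps : R), (1 < r' <= r)%N -> 0 < eps ->
  exists n0 : nat, forall n : nat, (n0 <= n)%N -> exists F : {set {set 'I_n}},
    [/\ is_rgraph r' F, cycle_free l F & n%:R `^ (1 + 1 / (l %/ 2)%:R - eps) <= #|F|%:R].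
Proof.
move=> l_gt1 hex r' eps r'r /hex[n0 hn0]; exists n0 => n /hn0 len.
have [G [sG frG cG]] := turan_attained (berge_cycles_upto l r) (complete_rgraph r n).
have rG : is_rgraph r G := is_rgraph_complete sG.
have cfG : cycle_free l G.
  case: frG => [->|]; last exact: berge_free_cycle_free.
  move=> [|p s] // _ _ _ sub; have := sub p.2; rewrite inE eqxx => /(_ isT).
  by rewrite inE.
(* Truncating edges supplies extremal hypergraphs of each smaller uniformity that merging can
   produce. *)
have [F [rF cfF cF]] := shrink_uniform l_gt1 r'r rG cfG.
by exists F; split=> //; rewrite cF cG.
Qed.

Lemma codegree_sub (V : finType) (H H' : {set {set V}}) (S : {set V}) :
  H' \subset H -> (codegree H' S <= codegree H S)%N.
Proof.
move=> sH; apply: subset_leq_card; apply/subsetP => e; rewrite !inE => /andP[eH ->].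
by rewrite (subsetP sH).
Qed.

(** Lightness is the codegree condition of [colouring_subgraph] for y close to D^(1/(r-1)); F is an
    extremal hypergraph on n = C y vertices. *)
Lemma light_subgraph (R : realType) (l r k : nat) (eps : R) :
  (1 < r)%N -> (0 < k)%N -> 0 < eps ->
  (exists n0 : nat, forall n : nat, (n0 <= n)%N -> exists F : {set {set 'I_n}},
    [/\ is_rgraph r F, cycle_free l F & n%:R `^ (1 + 1 / k%:R - eps) <= #|F|%:R]) ->
  exists2 c : R, 0 < c & forall (D : nat) (V : finType) (H : {set {set V}}),
    (0 < D)%N -> is_rgraph r H -> (forall x, codegree H [set x] <= D)%N ->
    (forall e S : {set V}, e \in H -> S \subset e -> (1 < #|S| < r)%N ->
       (codegree H S ^ r.-1 <= D ^ (r - #|S|))%N) ->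
    exists G : {set {set V}}, [/\ G \subset H, cycle_free l G &
      c * D%:R `^ (- 1 + 1 / ((r - 1) * k)%:R - eps) * #|H|%:R <= #|G|%:R].
Proof.
move=> r_gt1 k_gt0 eps_gt0 [n0 ext].
(* The first summand is what the colouring requires of n / y, the second forces n >= n0. *)
pose C := (r * 2 ^ r.+1 + n0)%N.
have r_gt0 : (0 < r)%N by apply: ltnW.
have r1_gt0 : (0 < r.-1)%N by rewrite -ltnS prednK.
have C_gt0 : (0 < C)%N by rewrite addn_gt0 muln_gt0 r_gt0 expn_gt0.
pose C2 : R := C%:R * 2.
have C2_gt0 : 0 < C2 by rewrite mulr_gt0 ?ltr0n.
exists (C2 `^ (1 + 1 / k%:R - eps - r%:R) / 2); first by rewrite divr_gt0 ?powR_gt0.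
move=> D V H D_gt0 rH degD light.
(* y exceeds x, so D <= y^(r-1), and x >= 1 gives y <= 2x, the source of the factor 2 in [C2]. *)
pose x : R := D%:R `^ (1 / (r - 1)%:R); pose y := (Num.truncn x).+1.
have x_ge1 : 1 <= x.
  by rewrite -(powRr0 D%:R); apply: ler_powR; rewrite ?ler1n // divr_ge0 ?ler0n.
have x_ge0 : 0 <= x by apply: le_trans x_ge1.
have /andP[yx xy] := truncn_itv x_ge0.
have y_le : y%:R <= 2 * x by rewrite /y -natr1; lra.
have leD : (D <= y ^ r.-1)%N.
  rewrite -(ler_nat R) natrX.
  have -> : D%:R = x ^+ r.-1.
    rewrite -powR_mulrn // /x -powRrM -subn1 div1r mulVf ?powRr1 ?ler0n //.
    by rewrite pnatr_eq0 subn1 -lt0n.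
  by apply: lerXn2r; rewrite ?nnegrE ?ler0n // ltW.
pose n := (C * y)%N.
have n_ge : (n0 <= n)%N by rewrite /n mulnS mulnDl /C; lia.
have [F [rF cfF leF]] := ext n n_ge.
have deg e : e \in H -> forall S : {set V}, S \subset e -> S != set0 ->
    (codegree H S <= y ^ (r - #|S|))%N.
  (* Three ranges: |S| = r leaves only e, |S| = 1 is the degree bound, the rest is lightness. *)
  move=> eH S Se; rewrite -card_gt0 => S_gt0.
  have : (#|S| <= r)%N by rewrite -(rH e eH) subset_leq_card.
  rewrite leq_eqVlt => /predU1P[Sr|ltS].
    rewrite Sr subnn expn0 -(cards1 e); apply: subset_leq_card; apply/subsetP => e'.
    rewrite !inE => /andP[e'H Se'].
    have eS : S = e by apply/eqP; rewrite eqEcard Se Sr (rH e eH) /=.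
    by rewrite eq_sym eqEcard -eS Se' Sr (rH e' e'H) /=.
  move: S_gt0; rewrite leq_eqVlt => /predU1P[S1|S_gt1].
    rewrite -S1 subn1; apply: leq_trans leD.
    have /cards1P[z ->] : #|S| == 1%N by rewrite -S1.
    exact: degD.
  rewrite -(leq_exp2r _ _ r1_gt0) -expnM mulnC expnM.
  apply: leq_trans (light e S eH Se _) _; first by rewrite S_gt1.
  by rewrite leq_exp2r // subn_gt0.
have y_gt0 : (0 < y)%N by [].
have Cle : (r * 2 ^ r.+1 * y <= n)%N by rewrite leq_mul2r leq_addr orbT.
have [G [sG cfG leG]] := colouring_subgraph r_gt0 rH rF cfF y_gt0 Cle deg.
exists G; split=> //.
have n_gt0 : 0 < n%:R :> R by rewrite ltr0n muln_gt0 C_gt0.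
have nr_gt0 : 0 < n%:R ^+ r :> R by rewrite exprn_gt0.
have len : n%:R <= C2 * D%:R `^ (1 / (r - 1)%:R) by rewrite -/x natrM -mulrA ler_wpM2l ?ler0n.
have D_ge1 : 1 <= D%:R :> R by rewrite ler1n.
have := colouring_density_exponent r_gt1 k_gt0 eps_gt0 D_ge1 C2_gt0 n_gt0 len.
set a := C2 `^ _; set b := D%:R `^ _ => le1.
have le2 : #|H|%:R * #|F|%:R <= 2 * #|G|%:R * n%:R ^+ r :> R.
  by rewrite -natrX -!natrM ler_nat.
have le3 : a * b * n%:R ^+ r <= #|F|%:R.
  by apply: le_trans leF; rewrite -ler_pdivlMr.
rewrite -(ler_pM2r nr_gt0).
have -> : a / 2 * b * #|H|%:R * n%:R ^+ r = (#|H|%:R * (a * b * n%:R ^+ r)) / 2 by field.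
rewrite ler_pdivrMr //; apply: le_trans (_ : #|H|%:R * #|F|%:R <= _).
  by rewrite ler_wpM2l ?ler0n.
have -> : #|G|%:R * n%:R ^+ r * 2 = 2 * #|G|%:R * n%:R ^+ r :> R by ring.
exact: le2.
Qed.

(** Pass to one class of [heavy_class], merge its kernels and apply the induction hypothesis to the
    quotient. One eps comes from that hypothesis, the second pays for the logarithmic number of
    classes. *)
Lemma heavy_subgraph (R : realType) (l r k : nat) (eps c : R) :
  (1 < r)%N -> (0 < k)%N -> 0 < eps -> 0 < c ->
  (forall (r' D : nat) (V : finType) (H : {set {set V}}), (1 < r' < r)%N ->
    (0 < D)%N -> is_rgraph r' H -> (forall x, codegree H [set x] <= D)%N ->
    exists G : {set {set V}}, [/\ G \subset H, tame l G &
      c * D%:R `^ (- 1 + 1 / ((r' - 1) * k)%:R - eps) * #|H|%:R <= #|G|%:R]) ->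
  exists2 c' : R, 0 < c' & forall (D : nat) (V : finType) (H Hh : {set {set V}}),
    (0 < D)%N -> is_rgraph r H -> (forall x, codegree H [set x] <= D)%N ->
    Hh \subset H -> Hh != set0 ->
    (forall e, e \in Hh -> exists S : {set V}, [/\ S \subset e, (1 < #|S| < r)%N &
      (D ^ (r - #|S|) < codegree H S ^ r.-1)%N]) ->
    exists G : {set {set V}}, [/\ G \subset Hh, tame l G &
      c' * D%:R `^ (- 1 + 1 / ((r - 1) * k)%:R - 2 * eps) * #|Hh|%:R <= #|G|%:R].
Proof.
move=> r_gt1 k_gt0 eps_gt0 c_gt0 IH.
have r_gt0 : (0 < r)%N by apply: ltnW.
have [kap kap_gt0 hkap] := trunc_log_le_powR eps_gt0.
pose A : R := (12 * r)%:R.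
have A_ge1 : 1 <= A by rewrite ler1n muln_gt0.
have A_gt0 : 0 < A by apply: lt_le_trans A_ge1.
pose B : R := (16 * r * 2 ^ r)%:R * r%:R.
have B_gt0 : 0 < B by rewrite mulr_gt0 // ltr0n // !muln_gt0 r_gt0 expn_gt0.
exists (c * (2^-1 * A `^ (- 1 - eps)) * kap / B).
  by rewrite divr_gt0 // mulr_gt0 // mulr_gt0 // mulr_gt0 ?invr_gt0 ?powR_gt0.
move=> D V H Hh D_gt0 rH degD sHh Hh0 heavy.
have [i [j [H2 [sigma [/andP[i_gt1 ltir] sH2 big hs leHh]]]]] := heavy_class D_gt0 Hh0 degD heavy.
set M := (2 ^ j)%N in big hs.
have M_gt0 : (0 < M)%N by rewrite expn_gt0.
have [e eH2] : exists e, e \in H2.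
  by apply/set0Pn; apply: contraTneq leHh => ->; rewrite cards0 muln0 -ltnNge card_gt0.
have leMD : (M <= D)%N.
  have [_ szi leM _] := hs e eH2; apply: leq_trans leM _.
  have /card_gt0P[x xs] : (0 < #|sigma e|)%N by rewrite szi ltnW.
  by apply: leq_trans (degD x); apply: codegreeS; rewrite sub1set.
have sH2H : H2 \subset H by apply: subset_trans sHh.
have [G1 [rho [sG1 fib rG' degG' leG']]] :=
  contract_heavy_kernels r_gt0 (ltnW i_gt1) M_gt0 rH degD sH2H hs.
set G' := [set _ | _ in G1] in rG' degG' leG'.
(* 1 < i < r puts the uniformity r - i + 1 strictly between 1 and r. *)
have [||G'' [sG'' tG'' leG'']] := IH (r - i).+1 (12 * r * M)%N V G' _ _ rG' degG'.
- by move: i_gt1 ltir; clear; lia.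
- by rewrite !muln_gt0 r_gt0.
have [G0 [sG0 tG0 cG0]] := tame_contraction fib sG'' tG''.
exists G0; split=> //; first by apply: subset_trans sG0 (subset_trans sG1 sH2).
rewrite cG0; apply: le_trans leG''.
have bigM : (D ^ (r - i) <= (2 * M) ^ (r - 1))%N by rewrite subn1 ltnW.
have MD : (0 < M <= D)%N by rewrite M_gt0.
have := merging_exponent ltir i_gt1 k_gt0 eps_gt0 A_ge1 MD bigM.
rewrite subSS subn0 [(12 * r * M)%:R]natrM -/A.
set p := (A * M%:R) `^ _; set a := A `^ _; set b := D%:R `^ _ => le1.
have DR : 0 < D%:R :> R by rewrite ltr0n.
have MR : 0 < M%:R :> R by rewrite ltr0n.
have le2 : M%:R * #|H2|%:R <= (16 * r * 2 ^ r)%:R * D%:R * #|G'|%:R :> R.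
  by rewrite -!natrM ler_nat.
have le3 : #|Hh|%:R <= r%:R * (trunc_log 2 D).+1%:R * #|H2|%:R :> R.
  by rewrite -!natrM ler_nat.
have le4 := hkap D D_gt0; set t := (trunc_log 2 D).+1%:R in le3 le4.
set s := D%:R `^ eps in le4; set h : R := #|Hh|%:R in le3 *; set h2 : R := #|H2|%:R in le2 le3.
set g : R := #|G'|%:R in le2 *.
have s_gt0 : 0 < s by apply: powR_gt0.
have -> : D%:R `^ (- 1 + 1 / ((r - 1) * k)%:R - 2 * eps) = D%:R^-1 * b / s.
  rewrite -(powR_inv1 (ltW DR)) -powRD; last by apply/implyP => _; rewrite gt_eqF.
  rewrite -powRB; last by apply/implyP => _; rewrite gt_eqF.
  by congr (_ `^ _); lra.
have le5 : kap * h <= r%:R * h2 * s.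
  apply: le_trans (_ : kap * (r%:R * t * h2) <= _); first by rewrite ler_wpM2l // ltW.
  have -> : kap * (r%:R * t * h2) = r%:R * h2 * (kap * t) by ring.
  by rewrite ler_wpM2l // mulr_ge0 ?ler0n.
have -> : c * (2^-1 * a) * kap / B * (D%:R^-1 * b / s) * h =
    c * (2^-1 * a * b) * (kap * h) / (B * D%:R * s).
  by field; rewrite !gt_eqF.
have BDs_gt0 : 0 < B * D%:R * s by apply: mulr_gt0 => //; apply: mulr_gt0.
rewrite ler_pdivrMr //.
apply: (@le_trans _ _ (c * (p * M%:R) * (r%:R * h2 * s))).
  apply: ler_pM; rewrite ?ler_wpM2l ?mulr_ge0 ?invr_ge0 ?powR_ge0 ?ler0n //;
    exact: ltW.
have -> : c * (p * M%:R) * (r%:R * h2 * s) = c * p * r%:R * s * (M%:R * h2) by ring.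
have -> : c * p * g * (B * D%:R * s) = c * p * r%:R * s * ((16 * r * 2 ^ r)%:R * D%:R * g).
  by rewrite /B; ring.
by rewrite ler_wpM2l // !mulr_ge0 ?powR_ge0 ?ler0n ?(ltW c_gt0).
Qed.

(** Induction on a bound m for the uniformity, with [eps] quantified inside: the heavy case calls
    the hypothesis at eps / 2 and loses the other half to the dyadic classes. *)
Lemma tame_subgraph (R : realType) (l r k : nat) :
  (1 < l)%N -> (0 < k)%N ->
  (forall (r' : nat) (eps : R), (1 < r' <= r)%N -> 0 < eps ->
    exists n0 : nat, forall n : nat, (n0 <= n)%N -> exists F : {set {set 'I_n}},
    [/\ is_rgraph r' F, cycle_free l F & n%:R `^ (1 + 1 / k%:R - eps) <= #|F|%:R]) ->
  forall (m : nat) (eps : R), 0 < eps -> exists2 c : R, 0 < c &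
    forall (r' D : nat) (V : finType) (H : {set {set V}}), (1 < r' <= r)%N -> (r' <= m)%N ->
    (0 < D)%N -> is_rgraph r' H -> (forall x, codegree H [set x] <= D)%N ->
    exists G : {set {set V}}, [/\ G \subset H, tame l G &
      c * D%:R `^ (- 1 + 1 / ((r' - 1) * k)%:R - eps) * #|H|%:R <= #|G|%:R].
Proof.
move=> l_gt1 k_gt0 ext; elim=> [|m IHm] eps eps_gt0.
  by exists 1 => // r' D V H /andP[r'1 _] r'0; move: (leq_trans r'1 r'0).
have eps2_gt0 : 0 < eps / 2 by rewrite divr_gt0.
have [c0 c0_gt0 hc0] := IHm eps eps_gt0.
have [c1 c1_gt0 hc1] := IHm (eps / 2) eps2_gt0.
(* For m = 0 or m >= r the new case r' = m + 1 violates 1 < r' <= r. *)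
have [/andP[m_gt0 mr]|nmr] := boolP (0 < m < r)%N; last first.
  exists c0 => // r' D V H r'r; rewrite leq_eqVlt => /predU1P[r'm|]; last exact: hc0.
  by case/negP: nmr; move: r'r; rewrite r'm ltnS.
have r_gt1 : (1 < m.+1)%N by [].
have m1r : (1 < m.+1 <= r)%N by rewrite r_gt1.
have [c2 c2_gt0 hc2] := light_subgraph r_gt1 k_gt0 eps_gt0 (ext m.+1 eps m1r eps_gt0).
have [|c3 c3_gt0 hc3] := @heavy_subgraph R l m.+1 k (eps / 2) c1 r_gt1 k_gt0 eps2_gt0 c1_gt0.
  move=> r' D V H /andP[r'_gt1 ltr'] D_gt0 rH degD; apply: hc1 => //.
  by rewrite r'_gt1 (leq_trans _ mr) // ltnW.
(* [c0] serves the smaller uniformities; the halving is there because only the larger of the light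
   and heavy parts is used. *)
exists (Num.min c0 (Num.min c2 c3 / 2)).
  by rewrite lt_min c0_gt0 divr_gt0 // lt_min c2_gt0.
move=> r' D V H r'r; rewrite leq_eqVlt => /predU1P[r'm|ltr'] D_gt0 rH degD; last first.
  have [G [sG tG leG]] := hc0 r' D V H r'r ltr' D_gt0 rH degD.
  exists G; split=> //; apply: le_trans leG; rewrite -!mulrA ler_wpM2r ?ge_min ?lexx //.
rewrite {r'}r'm in r'r rH *.
pose heavy (e : {set V}) := [exists S : {set V}, [&& S \subset e, (1 < #|S| < m.+1)%N &
  (D ^ (m.+1 - #|S|) < codegree H S ^ m)%N]].
pose Hh := [set e in H | heavy e]; pose Hl := [set e in H | ~~ heavy e].
have sHl : Hl \subset H by apply/subsetP => e; rewrite inE => /andP[].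
have sHh : Hh \subset H by apply/subsetP => e; rewrite inE => /andP[].
have cH : #|H|%:R <= #|Hl|%:R + #|Hh|%:R :> R.
  rewrite -natrD ler_nat; apply: leq_trans (leq_card_setU _ _); apply: subset_leq_card.
  by apply/subsetP => e eH; rewrite !inE eH /= orNb.
set u := D%:R `^ _; have u_ge0 : 0 <= u by apply: powR_ge0.
have min2 : Num.min c0 (Num.min c2 c3 / 2) <= c2 / 2.
  by rewrite !ge_min; apply/orP; right; rewrite ler_pM2r // ge_min lexx.
have min3 : Num.min c0 (Num.min c2 c3 / 2) <= c3 / 2.
  by rewrite !ge_min; apply/orP; right; rewrite ler_pM2r // ge_min lexx orbT.
have conclude (c' h : R) (g : nat) : Num.min c0 (Num.min c2 c3 / 2) <= c' / 2 -> 0 < c' ->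
    #|H|%:R <= 2 * h -> c' * u * h <= g%:R ->
    Num.min c0 (Num.min c2 c3 / 2) * u * #|H|%:R <= g%:R.
  move=> minc c'_gt0 leh; apply: le_trans.
  have -> : c' * u * h = c' / 2 * u * (2 * h) by field.
  apply: ler_pM => //; rewrite ?mulr_ge0 ?ler0n // ?ler_wpM2r //.
  by rewrite le_min (ltW c0_gt0) divr_ge0 // le_min !ltW.
have [leHl|ltHl] := leqP #|Hh| #|Hl|.
  have [| | |G [sG cfG leG]] := hc2 D V Hl D_gt0.
  - by move=> e /(subsetP sHl); apply: rH.
  - by move=> x; apply: leq_trans (codegree_sub _ sHl) (degD x).
  - move=> e S; rewrite inE => /andP[eH /existsPn/(_ S)].
    move=> + Se szS; rewrite Se szS /= -leqNgt; apply: leq_trans.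
    by rewrite leq_exp2r // codegree_sub.
  exists G; split; first exact: subset_trans sG sHl.
    (* A cycle-free hypergraph is tame with nothing merged. *)
    exists id; first by move=> e _ x y xe ->.
    by rewrite (eq_imset _ (@imset_id _)) imset_id.
  apply: conclude leG => //; apply: le_trans cH _.
  by rewrite mulr_natl mulr2n lerD2l ler_nat.
have [|||G [sG tG leG]] := hc3 D V H Hh D_gt0 rH degD.
- exact: sHh.
- by rewrite -card_gt0; apply: leq_ltn_trans ltHl.
- by move=> e; rewrite inE => /andP[_ /existsP[S /and3P[h1 h2 h3]]]; exists S.
exists G; split=> //; first exact: subset_trans sG sHh.
have e2 : 2 * (eps / 2) = eps by field.
rewrite e2 in leG; apply: conclude leG => //; apply: le_trans cH _.
by rewrite mulr_natl mulr2n lerD2r ler_nat ltnW.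
Qed.

(** * Thresholds for D and the complete hypergraph *)

Lemma powR_eventually_ge (R : realType) (c eps : R) : 0 < eps ->
  exists D0 : nat, forall D : nat, (D0 <= D)%N -> (0 < D)%N /\ c <= D%:R `^ eps.
Proof.
move=> eps_gt0; pose b := Num.max 1 c.
have b_ge1 : 1 <= b by rewrite le_max lexx.
have b_gt0 : 0 < b by apply: lt_le_trans b_ge1.
exists (Num.truncn (b `^ eps^-1)).+1 => D leD; split; first exact: leq_trans leD.
have bD : b `^ eps^-1 <= D%:R.
  have /andP[_ /ltW h] := truncn_itv (powR_ge0 b eps^-1).
  by apply: le_trans h _; rewrite ler_nat.
apply: le_trans (le_powR_base (powR_ge0 _ _) bD (ltW eps_gt0)).
by rewrite -powRrM mulVf ?gt_eqF // powRr1 ?(ltW b_gt0) // le_max lexx orbT.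
Qed.

Lemma leq_codegree_max_degree (V : finType) (H : hypergraph V) (x : V) :
  (codegree H [set x] <= max_degree H)%N.
Proof.
rewrite /max_degree.
apply: leq_trans (@leq_bigmax _ (fun v => #|[set e in H | v \in e]|) x).
by apply: subset_leq_card; apply/subsetP => e; rewrite !inE sub1set.
Qed.

Lemma ffact_ge (n m : nat) : ((n - m) ^ m <= n ^_ m)%N.
Proof.
rewrite ffact_prod -[m in (_ ^ m)%N]card_ord -prod_nat_const; apply: leq_prod => i _.
by rewrite leq_sub2l // ltnW.
Qed.

Lemma card_complete_rgraph (r n : nat) : #|complete_rgraph r n| = 'C(n, r).
Proof. by rewrite /complete_rgraph card_draws card_ord. Qed.

(** With x = D^(1/(r-1)), t is at most 3 x^(1+1/k), while n >= 2r gives n - r >= x/4 and hence at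
    least x^r / (4^r r!) edges. D^eps absorbs the constants. *)
Lemma turan_complete_upper (R : realType) (r k D d t : nat) (eps : R) :
  (1 < r)%N -> (0 < k)%N -> (0 < D)%N ->
  2 * r%:R + 1 <= D%:R `^ (1 / (r - 1)%:R) :> R ->
  3 * 4 ^+ r * (r`!)%:R <= D%:R `^ eps ->
  let n := Num.truncn (D%:R `^ (1 / (r - 1)%:R) : R) in
  (d ^ k <= n)%N -> (t <= d.+2 * n)%N ->
  t%:R <= D%:R `^ (- 1 + 1 / ((r - 1) * k)%:R + eps) * #|complete_rgraph r n|%:R.
Proof.
move=> r_gt1 k_gt0 D_gt0 xr De n dk tn; set x := D%:R `^ (1 / (r - 1)%:R) in xr n dk tn *.
have r_ge1 : 1 <= r%:R :> R by rewrite ler1n ltnW.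
have x_ge1 : 1 <= x by lra.
have x_gt0 : 0 < x by lra.
have /andP[nx xn] := truncn_itv (ltW x_gt0); rewrite -/n in nx xn.
have DR : 0 < D%:R :> R by rewrite ltr0n.
have r1 : (r - 1)%:R != 0 :> R by rewrite pnatr_eq0 subn_eq0 -ltnNge.
have k0 : k%:R != 0 :> R by rewrite pnatr_eq0 -lt0n.
have kV : 0 <= 1 / k%:R :> R by rewrite divr_ge0 ?ler0n.
have n2r : (2 * r <= n)%N.
  by rewrite -(ler_nat R) natrM; move: xn; rewrite -natr1; lra.
have dx : d%:R <= x `^ (1 / k%:R).
  apply: (@le_trans _ _ ((d%:R ^+ k) `^ (1 / k%:R))).
    by rewrite -powR_mulrn ?ler0n // -powRrM mulrC div1r mulVf // powRr1 ?ler0n.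
  by apply: le_powR_base; rewrite ?exprn_ge0 ?ler0n // -natrX (le_trans _ nx) // ler_nat.
have xk_ge1 : 1 <= x `^ (1 / k%:R) by rewrite -[X in X <= _](powRr0 x); apply: ler_powR.
have tx : t%:R <= 3 * x `^ (1 / k%:R) * x.
  apply: (@le_trans _ _ (d.+2%:R * n%:R)); first by rewrite -natrM ler_nat.
  by apply: ler_pM; rewrite ?ler0n // -[d.+2]addn2 natrD; lra.
have Kx : x ^+ r <= 4 ^+ r * (r`!)%:R * #|complete_rgraph r n|%:R.
  rewrite card_complete_rgraph -mulrA (mulrC (r`!)%:R) -natrM bin_ffact.
  apply: (@le_trans _ _ (4 ^+ r * ((n - r) ^ r)%:R)); last first.
    by rewrite ler_wpM2l ?exprn_ge0 // ler_nat ffact_ge.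
  rewrite natrX -exprMn; apply: lerXn2r; rewrite ?nnegrE ?(ltW x_gt0) ?mulr_ge0 ?ler0n //.
  rewrite natrB; last by apply: leq_trans n2r; rewrite leq_pmull.
  by move: n2r xn; rewrite -(ler_nat R) natrM -natr1; lra.
have -> : D%:R `^ (- 1 + 1 / ((r - 1) * k)%:R + eps) = x `^ (1 / k%:R) * x / x ^+ r * D%:R `^ eps.
  rewrite powRD; last by apply/implyP => _; rewrite gt_eqF.
  have -> : x `^ (1 / k%:R) * x = x `^ (1 / k%:R + 1).
    by rewrite powRD ?powRr1 ?(ltW x_gt0) //; apply/implyP => _; rewrite gt_eqF.
  congr (_ * _); rewrite -powR_mulrn ?(ltW x_gt0) //.
  rewrite -powRB; last by apply/implyP => _; rewrite gt_eqF.
  rewrite /x -powRrM natrM; congr (_ `^ _).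
  have -> : r%:R = (r - 1)%:R + 1 :> R by rewrite natrB ?subrK // ltnW.
  by field; rewrite r1 k0.
apply: le_trans tx _.
set K := #|_|%:R in Kx *; set s := D%:R `^ eps in De *; set q := x `^ _ * x.
have xr_gt0 : 0 < x ^+ r by rewrite exprn_gt0.
have q_gt0 : 0 < q by rewrite mulr_gt0 // powR_gt0.
have -> : q / x ^+ r * s * K = q * (s * K) / x ^+ r by field; rewrite gt_eqF.
have -> : 3 * x `^ (1 / k%:R) * x = q * 3 by rewrite /q; ring.
rewrite ler_pdivlMr // -mulrA ler_wpM2l ?(ltW q_gt0) //.
apply: (@le_trans _ _ (3 * (4 ^+ r * (r`!)%:R * K))); first by rewrite ler_wpM2l.
by rewrite !mulrA ler_wpM2r ?ler0n.
Qed.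

Theorem theorem1p1 (R : realType) (l r : nat) (hl : (3 <= l)%N) (hr : (3 <= r)%N)
  (hex : forall eps : R, 0 < eps -> exists n0 : nat, forall n : nat, (n0 <= n)%N ->
     n%:R `^ (1 + 1 / (l %/ 2)%:R - eps)
       <= (turan (berge_cycles_upto l r) (complete_rgraph r n))%:R) :
  (forall eps : R, 0 < eps -> exists D0 : nat, forall D : nat, (D0 <= D)%N ->
     forall (V : finType) (H : hypergraph V),
       is_rgraph r H -> (max_degree H <= D)%N ->
       D%:R `^ (- 1 + 1 / ((r - 1) * (l %/ 2))%:R - eps) * #|H|%:R
         <= (turan (nonsunflower_berge_cycles_upto l r) H)%:R)
  /\
  (forall eps : R, 0 < eps -> exists D0 : nat, forall D : nat, (D0 <= D)%N ->
     let K := complete_rgraph r (Num.truncn (D%:R `^ (1 / (r - 1)%:R) : R)) in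
     (turan (nonsunflower_berge_cycles_upto l r) K)%:R
       <= D%:R `^ (- 1 + 1 / ((r - 1) * (l %/ 2))%:R + eps) * #|K|%:R).
Proof.
have l_gt1 : (1 < l)%N by apply: ltnW.
have r_gt1 : (1 < r)%N by apply: ltnW.
have k_gt0 : (0 < l %/ 2)%N by rewrite divn_gt0.
split=> eps eps_gt0.
  have ext := extremal_uniform_graphs l_gt1 hex.
  (* Half of eps goes to [tame_subgraph], the other half absorbs its constant [c] for large D. *)
  have eps2_gt0 : 0 < eps / 2 by rewrite divr_gt0.
  have [c c_gt0 hc] := tame_subgraph l_gt1 k_gt0 ext r eps2_gt0.
  have [D0 hD0] := powR_eventually_ge c^-1 eps2_gt0.
  exists D0 => D /hD0[D_gt0 cD] V H rH degH.
  have [|||G [sG tG leG]] := hc r D V H _ _ D_gt0 rH.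
  - by rewrite r_gt1 leqnn.
  - by [].
  - by move=> x; apply: leq_trans (leq_codegree_max_degree H x) degH.
  apply: (@le_trans _ _ #|G|%:R); last by rewrite ler_nat; apply/turan_ge/tame_free.
  apply: le_trans leG; rewrite ler_wpM2r ?ler0n //.
  set u := - 1 + _.
  have -> : u - eps = (u - eps / 2) - eps / 2 by field.
  rewrite powRB; last by apply/implyP => _; rewrite gt_eqF // ltr0n.
  rewrite mulrC ler_wpM2r ?powR_ge0 // -[c]invrK lef_pV2 ?posrE ?invr_gt0 //.
  by rewrite powR_gt0 // ltr0n.
have m_gt0 : 0 < 1 / (r - 1)%:R :> R by rewrite divr_gt0 // ltr0n subn_gt0.
(* Beyond [D1] there are at least 2r vertices; beyond [D2] the power D^eps outgrows the
   constants. *)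
have [D1 hD1] := powR_eventually_ge (2 * r%:R + 1) m_gt0.
have [D2 hD2] := powR_eventually_ge (3 * 4 ^+ r * (r`!)%:R) eps_gt0.
exists (maxn D1 D2) => D; rewrite geq_max => /andP[/hD1[D_gt0 xr] /hD2[_ De]].
pose n := Num.truncn (D%:R `^ (1 / (r - 1)%:R) : R).
have n_gt0 : (0 < n)%N.
  rewrite truncn_gt0; apply: le_trans xr; have := ler0n R r; lra.
have [|d [dk tn]] := @turan_nonsunflower_bound l r n (complete_rgraph r n) hl hr _ n_gt0.
  exact: is_rgraph_complete.
exact: turan_complete_upper dk tn.
Qed.
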